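(* Let $p,q$ be nonnegative integers, let $\kappa_1,\dots,\kappa_p,\mu_1,\dots,\mu_q$ be complex numbers none of which is in $\{0,-1,-2,\dots\}$, let $\alpha,\beta\in\mathbb{C}$ with $\Re(\alpha)>0$, let $\lambda_2,\lambda_3\in\mathbb{C}$ with $\Re(\lambda_3)>\Re(\lambda_2)>0$, let $s\in\mathbb{C}$ with $\Re(s)>0$, and let $z\in\mathbb{C}$. Then the Laplace transform in $\rho$ of the M-confluent hypergeometric function is $$\int_0^\infty e^{-s\rho}\;{}^{M}\Phi_{p,q}^{(\alpha,\beta)}(\kappa_1,\dots,\kappa_p;\mu_1,\dots,\mu_q;\lambda_{2};\lambda_{3};z;\rho)\,d\rho =\frac{1}{s}\;{}^{M}\Phi_{p+1,q}^{(\alpha,\beta)}\left(\kappa_{1},\ldots,\kappa_p,1;\mu_1,\ldots,\mu_q;\lambda_{2};\lambda_{3};z;\frac{1}{s}\right).$$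
   Context: $(\lambda)_m=\Gamma(\lambda+m)/\Gamma(\lambda)$, $(\lambda)_0=1$ is the Pochhammer symbol and $B(x,y)=\int_0^1 t^{x-1}(1-t)^{y-1}dt$ is the classical beta function. The generalized M-series is $${}_{p}^{\alpha}M^{\beta}_{q}(\kappa_{1},\ldots,\kappa_{p};\mu_{1},\ldots,\mu_{q};z)=\sum_{m=0}^{\infty}\frac{(\kappa_{1})_{m}\cdots(\kappa_p)_{m}}{(\mu_1)_{m}\cdots(\mu_q)_{m}}\frac{z^{m}}{\Gamma(\alpha m+\beta)}.$$ The modified beta (M-beta) and modified confluent hypergeometric (M-confluent hypergeometric) functions are $${}^{M}B_{p,q}^{(\alpha,\beta)}(\kappa_{1},\ldots,\kappa_p;\mu_1,\ldots,\mu_q;x,y;\rho)=\int_{0}^{1}t^{x-1}(1-t)^{y-1}\,{}_{p}^{\alpha}M^{\beta}_{q}\left(\kappa_{1},\ldots,\kappa_{p};\mu_{1},\ldots,\mu_{q};\frac{-\rho}{t(1-t)}\right) dt,$$ $${}^{M}\Phi_{p,q}^{(\alpha,\beta)}(\kappa_{1},\ldots,\kappa_p;\mu_1,\ldots,\mu_q;\lambda_{2};\lambda_{3};z;\rho)=\sum_{n=0}^{\infty}\frac{{}^{M}B_{p,q}^{(\alpha,\beta)}(\kappa_{1},\ldots,\kappa_p;\mu_1,\ldots,\mu_q;\lambda_{2}+n,\lambda_{3}-\lambda_{2};\rho)}{B(\lambda_{2},\lambda_{3}-\lambda_{2})}\frac{z^{n}}{n!}.$$ These functions are defined for those parameters and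 arguments for which the series and integrals converge. *)

(* Defs.v *)
From HB Require Import structures.
From mathcomp Require Import all_boot all_order all_algebra.
From mathcomp Require Import all_classical all_reals all_analysis.
From mathcomp Require Import complex.

Set Implicit Arguments.
Unset Strict Implicit.
Unset Printing Implicit Defensive.

Import Order.TTheory GRing.Theory Num.Theory.
Import numFieldNormedType.Exports.

Local Open Scope classical_set_scope.
Local Open Scope ring_scope.
Local Open Scope complex_scope.

(* The libraries provide neither complex-valued integrals, nor the complex
   exponential, nor Gamma and Beta at complex arguments. Integrals are Lebesgue
   integrals, so "the integral converges" means Lebesgue integrability. *)

Section ComplexAnalysis.
Variable R : realType.
Implicit Types (D : set R) (f : R -> R[i]) (t : R) (u : R[i]^nat)
  (x y z : R[i]).

Definition Cintegrable D f : Prop :=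
  (@lebesgue_measure R).-integrable D (EFin \o (fun t => complex.Re (f t))) /\
  (@lebesgue_measure R).-integrable D (EFin \o (fun t => complex.Im (f t))).

Definition Cintegral D f : R[i] :=
  Rintegral (@lebesgue_measure R) D (fun t => complex.Re (f t)) +i*
  Rintegral (@lebesgue_measure R) D (fun t => complex.Im (f t)).

Definition Cseries_cvg u : Prop := cvgn (series u : nat -> R[i]^o).

Definition Cseries_sum u : R[i] := limn (series u : nat -> R[i]^o).

Definition cexp z : R[i] :=
  (expR (complex.Re z))%:C * (cos (complex.Im z) +i* sin (complex.Im z)).

(* Only used for t > 0, where it is exp (z * ln t). *)
Definition rcpow t z : R[i] := cexp (z * (ln t)%:C).

Definition Gamma_integral z : R[i] :=
  Cintegral `]0, +oo[ (fun t => rcpow t (z - 1) * (expR (- t))%:C).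

(* Outside the half-plane Re z > 0, Gamma is continued by
   Gamma z = Gamma (z + n) / (z (z + 1) ... (z + n - 1)), with n the least
   natural number such that Re z + n > 0. At the poles 0, -1, -2, ... the
   denominator vanishes, so Gamma z = 0 and (Gamma z)^-1 = 0: this is the value
   of the entire function 1 / Gamma, as needed in the M-series, where
   alpha * m + beta may be a pole. *)
Definition Gamma z : R[i] :=
  if 0 < complex.Re z then Gamma_integral z
  else let n := (Num.truncn (- complex.Re z)).+1 in
       Gamma_integral (z + n%:R) / \prod_(i < n) (z + i%:R).

Definition beta_integrand x y t : R[i] :=
  rcpow t (x - 1) * rcpow (1 - t) (y - 1).

Definition Beta x y : R[i] := Cintegral `]0, 1[ (beta_integrand x y).

Definition pochhammer z (m : nat) : R[i] :=
  if m == 0%N then 1 else Gamma (z + m%:R) / Gamma z.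

Definition nonpole z : Prop := forall k : nat, z <> - k%:R.

End ComplexAnalysis.

Section MFunctions.
Variables (R : realType) (p q : nat) (alpha beta : R[i]).
Variables (kappa : p.-tuple R[i]) (mu : q.-tuple R[i]).
Implicit Types x y z rho : R[i].

Definition Mseries_term z (m : nat) : R[i] :=
  (\prod_(i < p) pochhammer (tnth kappa i) m) /
  (\prod_(j < q) pochhammer (tnth mu j) m) *
  (z ^+ m / Gamma (alpha * m%:R + beta)).

Definition Mseries_cvg z : Prop := Cseries_cvg (Mseries_term z).

Definition Mseries z : R[i] := Cseries_sum (Mseries_term z).

Definition Mbeta_integrand x y rho (t : R) : R[i] :=
  beta_integrand x y t * Mseries (- rho / (t * (1 - t))%:C).

Definition Mbeta_cvg x y rho : Prop :=
  (forall t : R, 0 < t < 1 -> Mseries_cvg (- rho / (t * (1 - t))%:C)) /\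
  Cintegrable `]0, 1[ (Mbeta_integrand x y rho).

Definition Mbeta x y rho : R[i] :=
  Cintegral `]0, 1[ (Mbeta_integrand x y rho).

Definition Mconfluent_term (lambda2 lambda3 : R[i]) z rho (n : nat) : R[i] :=
  Mbeta (lambda2 + n%:R) (lambda3 - lambda2) rho
    / Beta lambda2 (lambda3 - lambda2) * (z ^+ n / (n`!)%:R).

Definition Mconfluent_cvg (lambda2 lambda3 : R[i]) z rho : Prop :=
  (forall n : nat, Mbeta_cvg (lambda2 + n%:R) (lambda3 - lambda2) rho) /\
  Cseries_cvg (Mconfluent_term lambda2 lambda3 z rho).

Definition Mconfluent (lambda2 lambda3 : R[i]) z rho : R[i] :=
  Cseries_sum (Mconfluent_term lambda2 lambda3 z rho).

End MFunctions.

(* Main.v *)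
(* Write M(w) = sum a_m w^m for the M-series. The right-hand M-series has the
   extra parameter 1, hence general term m! a_m w^m, and it converges at
   w = -1/(s t (1 - t)) for all t in ]0, 1[, that is for arbitrarily large |w|.
   So sum |a_m| m! r^m is finite for every r; M is entire and O(exp (c |w|)) for
   every c > 0, and termwise integration gives, for fixed t,
     int_0^oo exp (- s rho) M(- rho u) d rho = 1/s sum m! a_m (- u/s)^m.
   Exchanging this with the t-integral of the M-beta function requires a bound of
     G(rho) = int_0^1 |t^(x-1) (1-t)^(y-1) M(- rho/(t (1-t)))| dt,
   which is only known to be finite for each rho. It has at most exponential
   growth of arbitrarily small rate: near t = 0 the substitution
   w = t (1 - t)/rho shows that the integral scales like rho^(Re x), so that
   finiteness at rho = 1 controls all rho; likewise near t = 1. This bound makes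
   Fubini applicable for each n and also dominates the sum over n. *)

Require Import Defs.
From HB Require Import structures.
From mathcomp Require Import all_boot all_order all_algebra.
From mathcomp Require Import all_classical all_reals all_analysis.
From mathcomp Require Import measurable_realfun complex ring lra.

Set Implicit Arguments.
Unset Strict Implicit.
Unset Printing Implicit Defensive.

Import Order.TTheory GRing.Theory Num.Theory.
Import numFieldNormedType.Exports.

Local Open Scope classical_set_scope.
Local Open Scope ring_scope.
Local Open Scope complex_scope.

(** The growth bound on the M-series cannot be inserted under the t-integral: exp (c rho/(t (1 -
    t))) is not integrable at the endpoints. It is used for fixed t and for t away from 0 and 1;
    near the endpoints, absolute convergence has to come from the M-beta integral itself, where it
    is given for each rho without any uniformity. The scaling argument supplies the uniformity. The
    cut at t = 1/4 keeps the Jacobian 1 - 2 t and the powers of 1 - t between positive constants, so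
    that the change of variable costs constant factors. The delicate case is small rho: the range of
    w then exceeds the one for rho = 1, and finiteness at rho = 1 says nothing about the excess.
    There the M-series is taken at bounded arguments, so its part below a constant is split off and
    integrated against t^(Re x - 1) alone. A growth rate c = Re s / 2 is enough: against the decay
    exp (- 2 c rho) it leaves the integrable majorant exp (- c rho). Since t^n <= 1 on ]0, 1[, the
    estimate for n = 0 holds for every n with the same constant. *)

Local Notation normc := (@ComplexField.Normc.normc _).

(** * Complex norms and series *)

Section ComplexNorm.
Context {R : realType}.
Implicit Types (x y z : R[i]) (u v : R[i]^nat).

Lemma normcE z : `|z| = (normc z)%:C. Proof. by []. Qed.

Lemma normc_ge0 z : 0 <= normc z.
Proof. by case: z => a b; exact: sqrtr_ge0. Qed.

Lemma normc_real (a : R) : normc (a%:C) = `|a|.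
Proof. by rewrite /= expr0n addr0 sqrtr_sqr. Qed.

Lemma ler_normcD x y : normc (x + y) <= normc x + normc y.
Proof. by rewrite -lecR rmorphD /= -!normcE ler_normD. Qed.

Lemma normcN x : normc (- x) = normc x.
Proof. by case: x => a b /=; rewrite !sqrrN. Qed.

Lemma ler_Re_normc z : `|complex.Re z| <= normc z.
Proof.
case: z => a b /=; rewrite -sqrtr_sqr ler_wsqrtr// lerDl sqr_ge0//.
Qed.

Lemma ler_Im_normc z : `|complex.Im z| <= normc z.
Proof.
case: z => a b /=; rewrite -sqrtr_sqr ler_wsqrtr// lerDr sqr_ge0//.
Qed.

Lemma normc_le z : normc z <= `|complex.Re z| + `|complex.Im z|.
Proof.
rewrite [in leLHS](complexE z) (le_trans (ler_normcD _ _))//.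
by rewrite ComplexField.Normc.normcM !normc_real lerD2l /= expr0n expr1n add0r
  sqrtr1 mul1r.
Qed.

Lemma normcX z n : normc (z ^+ n) = normc z ^+ n.
Proof.
elim: n => [|n ih]; first by rewrite !expr0 ComplexField.Normc.normc1.
by rewrite !exprS ComplexField.Normc.normcM ih.
Qed.

Lemma ler_normc_sum I (r : seq I) (P : pred I) (F : I -> R[i]) :
  normc (\sum_(i <- r | P i) F i) <= \sum_(i <- r | P i) normc (F i).
Proof.
elim/big_rec2: _ => [|i y x _ h]; first by rewrite ComplexField.Normc.normc0.
by rewrite (le_trans (ler_normcD _ _))// lerD2l.
Qed.

Lemma cReD x y : complex.Re (x + y) = complex.Re x + complex.Re y.
Proof. by case: x; case: y. Qed.

Lemma cImD x y : complex.Im (x + y) = complex.Im x + complex.Im y.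
Proof. by case: x; case: y. Qed.

Lemma cReB x y : complex.Re (x - y) = complex.Re x - complex.Re y.
Proof. by case: x; case: y. Qed.

Lemma cImB x y : complex.Im (x - y) = complex.Im x - complex.Im y.
Proof. by case: x; case: y. Qed.

Lemma cReN x : complex.Re (- x) = - complex.Re x.
Proof. by case: x. Qed.

Lemma cImN x : complex.Im (- x) = - complex.Im x.
Proof. by case: x. Qed.

Lemma cReM x y : complex.Re (x * y) =
  complex.Re x * complex.Re y - complex.Im x * complex.Im y.
Proof. by case: x; case: y. Qed.

Lemma cImM x y : complex.Im (x * y) =
  complex.Re x * complex.Im y + complex.Im x * complex.Re y.
Proof. by case: x; case: y. Qed.

Lemma Re_sum I (r : seq I) (P : pred I) (F : I -> R[i]) :
  complex.Re (\sum_(i <- r | P i) F i) = \sum_(i <- r | P i) complex.Re (F i).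
Proof. by apply: (big_morph (@complex.Re R)) => // x y; rewrite cReD. Qed.

Lemma Im_sum I (r : seq I) (P : pred I) (F : I -> R[i]) :
  complex.Im (\sum_(i <- r | P i) F i) = \sum_(i <- r | P i) complex.Im (F i).
Proof. by apply: (big_morph (@complex.Im R)) => // x y; rewrite cImD. Qed.

Lemma complex_ext x y : complex.Re x = complex.Re y ->
  complex.Im x = complex.Im y -> x = y.
Proof. by case: x; case: y => ? ? ? ? /= -> ->. Qed.

Lemma cvgn_complex u x :
  (fun n => complex.Re (u n)) @ \oo --> complex.Re x ->
  (fun n => complex.Im (u n)) @ \oo --> complex.Im x ->
  (u : nat -> R[i]^o) @ \oo --> (x : R[i]^o).
Proof.
move=> /cvgrPdist_lt cRe /cvgrPdist_lt cIm; apply/cvgrPdist_lt => e.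
(* Positivity in the order of [R[i]] forces a zero imaginary part, so [e] is a real number. *)
rewrite ltcE => /andP[/eqP /= Ime e0].
have e2 : 0 < complex.Re e / 2 by rewrite divr_gt0.
have -> : e = (complex.Re e)%:C by apply: complex_ext.
near=> n; rewrite normcE ltcR (le_lt_trans (normc_le _))//.
rewrite cReB cImB.
have nRe : `|complex.Re x - complex.Re (u n)| < complex.Re e / 2.
  by near: n; exact: cRe.
have nIm : `|complex.Im x - complex.Im (u n)| < complex.Re e / 2.
  by near: n; exact: cIm.
by rewrite (splitr (complex.Re e)) ltrD.
Unshelve. all: by end_near. Qed.

(** Even conditional convergence bounds the terms, and terms bounded at one radius make a power
    series absolutely summable at half that radius. The summability of the M-series coefficients
    rests on this. *)
Lemma Cseries_terms_bounded u : Cseries_cvg u ->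
  exists K, forall n, normc (u n) <= K.
Proof.
move=> /cvg_series_cvg_0 cu.
have /cvg_seq_bounded : cvgn (u : nat -> R[i]^o) by apply/cvg_ex; exists 0.
move=> [M [Mr hM]].
exists (complex.Re (M + 1)) => n.
have := hM (M + 1) _ n I; rewrite ltrDl ltr01 => /(_ erefl) /=.
by rewrite normcE lecE => /andP[].
Qed.

Lemma cvg_series_bounded_norm (u : R^nat) (K : R) :
  (forall n, \sum_(0 <= k < n) `|u k| <= K) -> cvgn (series u).
Proof.
move=> uK; apply: normed_cvg; apply: nondecreasing_is_cvgn.
  by apply: nondecreasing_series => n _ _ ; exact: normr_ge0.
by exists K => _ [n _ <-]; exact: uK.
Qed.

(** Absolute convergence is expressed throughout by a bound on all partial sums of norms: the same
    bound gives convergence, an estimate of the sum, and domination under an integral. The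
    componentwise formula gives access to the theorems on real series. *)
Lemma abs_cvg_Cseries u (K : R) :
  (forall n, \sum_(0 <= k < n) normc (u k) <= K) ->
  (series u : nat -> R[i]^o) @ \oo --> (Cseries_sum u : R[i]^o) /\
  Cseries_sum u = limn (series (fun k => complex.Re (u k))) +i*
                  limn (series (fun k => complex.Im (u k))).
Proof.
move=> uK.
have cRe : cvgn (series (fun k => complex.Re (u k))).
  apply: (@cvg_series_bounded_norm _ K) => n; apply: le_trans (uK n).
  by apply: ler_sum => k _; exact: ler_Re_normc.
have cIm : cvgn (series (fun k => complex.Im (u k))).
  apply: (@cvg_series_bounded_norm _ K) => n; apply: le_trans (uK n).
  by apply: ler_sum => k _; exact: ler_Im_normc.
have cu : (series u : nat -> R[i]^o) @ \oo -->
    (limn (series (fun k => complex.Re (u k))) +i*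
     limn (series (fun k => complex.Im (u k))) : R[i]^o).
  apply: cvgn_complex => /=.
    rewrite [X in X @ _ --> _](_ : _ = series (fun k => complex.Re (u k)))//.
    by apply/funext => n; rewrite /series/= Re_sum.
  rewrite [X in X @ _ --> _](_ : _ = series (fun k => complex.Im (u k)))//.
  by apply/funext => n; rewrite /series/= Im_sum.
have E := cvg_lim (@norm_hausdorff _ _) cu.
by split; rewrite /Cseries_sum E.
Qed.

Lemma normc_Cseries_sum u (K : R) :
  (forall n, \sum_(0 <= k < n) normc (u k) <= K) -> normc (Cseries_sum u) <= K.
Proof.
move=> uK; have [/cvgrPdist_lt cu _] := abs_cvg_Cseries uK.
apply/ler_addgt0Pr => e e0; have /cu [n _ /(_ n (leqnn n))] : (0 : R[i]) < e%:C.
  by rewrite ltcR.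
rewrite normcE ltcR => /ltW h.
rewrite -(subrK (series u n) (Cseries_sum u)) addrC (le_trans (ler_normcD _ _))//.
by rewrite lerD// (le_trans _ (uK n))// ler_normc_sum.
Qed.

End ComplexNorm.

(** * Complex-valued Lebesgue integrals *)

Section ComplexIntegral.
Context {R : realType}.
Local Notation mu := (@lebesgue_measure R).

(** Componentwise, to match [Cintegrable]; the domain is arbitrary so that kernels of two variables
    are covered. *)
Definition Cmeasurable d (T : measurableType d) (D : set T) (f : T -> R[i]) :=
  measurable_fun D (fun t => complex.Re (f t)) /\
  measurable_fun D (fun t => complex.Im (f t)).

Section Cmeasurable.
Context d (T : measurableType d) (D : set T).
Implicit Types f g : T -> R[i].

Lemma Cmeasurable_cst (c : R[i]) : Cmeasurable D (fun=> c).
Proof. by split; exact: measurable_cst. Qed.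

Lemma Cmeasurable_real (f : T -> R) :
  measurable_fun D f -> Cmeasurable D (fun t => (f t)%:C).
Proof. by move=> mf; split => //; exact: measurable_cst. Qed.

Lemma CmeasurableM f g :
  Cmeasurable D f -> Cmeasurable D g -> Cmeasurable D (fun t => f t * g t).
Proof.
move=> [f1 f2] [g1 g2]; split.
  apply: (@eq_measurable_fun _ _ _ _ _ (fun t => complex.Re (f t) *
    complex.Re (g t) - complex.Im (f t) * complex.Im (g t))).
    by move=> t _; rewrite cReM.
  by apply: measurable_funB; exact: measurable_funM.
apply: (@eq_measurable_fun _ _ _ _ _ (fun t => complex.Re (f t) *
    complex.Im (g t) + complex.Im (f t) * complex.Re (g t))).
  by move=> t _; rewrite cImM.
by apply: measurable_funD; exact: measurable_funM.
Qed.

Lemma eq_Cmeasurable f g : {in D, f =1 g} -> Cmeasurable D f -> Cmeasurable D g.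
Proof.
move=> fg [f1 f2]; split.
  by apply: eq_measurable_fun f1 => x /fg ->.
by apply: eq_measurable_fun f2 => x /fg ->.
Qed.

Lemma CmeasurableX f n :
  Cmeasurable D f -> Cmeasurable D (fun t => f t ^+ n).
Proof.
move=> mf; elim: n => [|n ih].
  by apply: eq_Cmeasurable (Cmeasurable_cst 1) => t _; rewrite expr0.
by apply: eq_Cmeasurable (CmeasurableM mf ih) => t _; rewrite exprS.
Qed.

Lemma Cmeasurable_cexp f :
  Cmeasurable D f -> Cmeasurable D (fun t => cexp (f t)).
Proof.
move=> [f1 f2]; apply: CmeasurableM.
  by apply: Cmeasurable_real; exact: measurableT_comp.
split => /=.
  apply: (measurableT_comp (f := cos)) => //.
  by apply: continuous_measurable_fun; exact: continuous_cos.
apply: (measurableT_comp (f := sin)) => //.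
by apply: continuous_measurable_fun; exact: continuous_sin.
Qed.

Lemma Cmeasurable_rcpow (f : T -> R) z :
  measurable_fun D f -> Cmeasurable D (fun t => rcpow (f t) z).
Proof.
move=> mf; apply: Cmeasurable_cexp; apply: CmeasurableM.
  exact: Cmeasurable_cst.
by apply: Cmeasurable_real; exact: measurableT_comp.
Qed.

Lemma measurable_normc f :
  Cmeasurable D f -> measurable_fun D (fun t => normc (f t)).
Proof.
move=> [f1 f2].
rewrite (_ : (fun t => _) =
  (fun t => Num.sqrt (complex.Re (f t) ^+ 2 + complex.Im (f t) ^+ 2))).
  apply: (@measurableT_comp _ _ _ _ _ _ (@Num.sqrt R : R -> R) D
    (fun t => complex.Re (f t) ^+ 2 + complex.Im (f t) ^+ 2)).
    by apply: continuous_measurable_fun; exact: sqrt_continuous.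
  by apply: measurable_funD; exact: measurable_funX.
by apply/funext => t; case: (f t).
Qed.

End Cmeasurable.

(** Dominated convergence applied to the partial sums. As [H] bounds the partial sums of absolute
    values, it provides pointwise convergence of the series together with the domination. *)
Lemma Rintegral_series (D : set R) (g : nat -> R -> R) (H : R -> R) :
  measurable D ->
  (forall n, measurable_fun D (g n)) ->
  mu.-integrable D (EFin \o H) ->
  (forall n t, D t -> \sum_(0 <= k < n) `|g k t| <= H t) ->
  [/\ forall n, mu.-integrable D (EFin \o g n),
      mu.-integrable D (EFin \o (fun t => limn (series (g^~ t)))) &
      series (fun n => Rintegral mu D (g n)) @ \oo -->
        Rintegral mu D (fun t => limn (series (g^~ t)))].
Proof.
move=> mD mg iH gH.
have gi n : mu.-integrable D (EFin \o g n).
  apply: le_integrable iH => //; first by apply/measurable_EFinP; exact: mg.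
  move=> t Dt /=; rewrite lee_fin (le_trans _ (ler_norm _))//.
  apply: le_trans (gH n.+1 t Dt); rewrite big_nat_recr//= lerDr.
  by apply: sumr_ge0 => k _.
have cv t : D t -> cvgn (series (g^~ t)).
  by move=> Dt; apply: (@cvg_series_bounded_norm _ _ (H t)) => n; exact: gH.
pose S n t := series (g^~ t) n.
have mS n : measurable_fun D (S n).
  by apply: measurable_sum => k; exact: mg.
have mlim : measurable_fun D (fun t => limn (series (g^~ t))).
  by apply: (measurable_fun_cvg mS) => t Dt; exact: cv.
have := @dominated_convergence _ _ _ mu D mD (fun n => EFin \o S n)
  (EFin \o (fun t => limn (series (g^~ t)))) (EFin \o H).
case.
- by move=> n; apply/measurable_EFinP; exact: mS.
- by apply/measurable_EFinP; exact: mlim.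
- by apply/aeW => t Dt; apply/cvg_EFin; [exact: nearW|exact: cv].
- exact: iH.
- apply/aeW => t n Dt; rewrite lee_fin; apply: le_trans (gH n t Dt).
  exact: ler_norm_sum.
move=> il _ cl; split => //.
have -> : series (fun n => Rintegral mu D (g n)) =
    (fun n => fine (\int[mu]_(x in D) (EFin \o S n) x)%E).
  apply/funext => n; rewrite /series/= /S /series/=.
  rewrite -[RHS]/(Rintegral mu D (fun t => \sum_(0 <= k < n) g k t)).
  elim: n => [|n ih].
    rewrite big_nil; under eq_Rintegral do rewrite big_nil.
    by rewrite Rintegral_cst ?mul0r.
  rewrite big_nat_recr//= ih -RintegralD//.
    by apply: eq_Rintegral => t _; rewrite big_nat_recr.
  have := @integrable_sum _ _ _ mu D mD _ (index_iota 0 n) xpredT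
    (fun k => EFin \o g k) (fun k _ => gi k).
  by apply: eq_integrable => // t _; rewrite /= sumEFin.
by apply: fine_cvg; rewrite fineK//; exact: integrable_fin_num.
Qed.

Lemma Cintegral_series (D : set R) (g : nat -> R -> R[i]) (H : R -> R) :
  measurable D ->
  (forall n, Cmeasurable D (g n)) ->
  mu.-integrable D (EFin \o H) ->
  (forall n t, D t -> \sum_(0 <= k < n) normc (g k t) <= H t) ->
  [/\ forall n, Cintegrable D (g n),
      Cintegrable D (fun t => Cseries_sum (g^~ t)) &
      Cintegral D (fun t => Cseries_sum (g^~ t)) =
      Cseries_sum (fun n => Cintegral D (g n))].
Proof.
move=> mD mg iH gH.
have [i1 l1 c1] := @Rintegral_series D (fun n t => complex.Re (g n t)) H mD
  (fun n => (mg n).1) iH (fun n t Dt => le_trans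
    (ler_sum _ (fun k _ => ler_Re_normc (g k t))) (gH n t Dt)).
have [i2 l2 c2] := @Rintegral_series D (fun n t => complex.Im (g n t)) H mD
  (fun n => (mg n).2) iH (fun n t Dt => le_trans
    (ler_sum _ (fun k _ => ler_Im_normc (g k t))) (gH n t Dt)).
have E t : D t -> Cseries_sum (g^~ t) =
    limn (series (fun k => complex.Re (g k t))) +i*
    limn (series (fun k => complex.Im (g k t))).
  by move=> Dt; have [] := abs_cvg_Cseries (gH^~ t ^~ Dt).
split.
- by move=> n; split; [exact: i1|exact: i2].
- split.
    by apply: eq_integrable l1 => // t /[!inE] /E /= ->.
  by apply: eq_integrable l2 => // t /[!inE] /E /= ->.
suff c : (series (fun n => Cintegral D (g n)) : nat -> R[i]^o) @ \oo -->
    (Cintegral D (fun t => Cseries_sum (g^~ t)) : R[i]^o).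
  by rewrite /Cseries_sum (cvg_lim (@norm_hausdorff _ _) c).
apply: cvgn_complex => /=.
  rewrite (_ : Rintegral _ _ _ =
      Rintegral mu D (fun t => limn (series (fun k => complex.Re (g k t))))); last first.
    by apply: eq_Rintegral => t /[!inE] /E ->.
  rewrite [X in X @ _ --> _](_ : _ =
    series (fun n => Rintegral mu D (fun t => complex.Re (g n t))))//.
  by apply/funext => n; rewrite /series/= Re_sum.
rewrite (_ : Rintegral _ _ _ =
    Rintegral mu D (fun t => limn (series (fun k => complex.Im (g k t))))); last first.
  by apply: eq_Rintegral => t /[!inE] /E ->.
rewrite [X in X @ _ --> _](_ : _ =
  series (fun n => Rintegral mu D (fun t => complex.Im (g n t))))//.
by apply/funext => n; rewrite /series/= Im_sum.
Qed.

Lemma eq_Cintegral (D : set R) (f g : R -> R[i]) :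
  {in D, f =1 g} -> Cintegral D f = Cintegral D g.
Proof.
move=> fg; congr (_ +i* _); apply: eq_Rintegral => t Dt; by rewrite fg.
Qed.

Lemma eq_Cintegrable (D : set R) (f g : R -> R[i]) : measurable D ->
  {in D, f =1 g} -> Cintegrable D f -> Cintegrable D g.
Proof.
move=> mD fg [f1 f2]; split.
  by apply: eq_integrable f1 => // t Dt /=; rewrite fg.
by apply: eq_integrable f2 => // t Dt /=; rewrite fg.
Qed.

Lemma CintegralZl (D : set R) (c : R[i]) (f : R -> R[i]) : measurable D ->
  Cintegrable D f ->
  Cintegrable D (fun t => c * f t) /\
  Cintegral D (fun t => c * f t) = c * Cintegral D f.
Proof.
move=> mD [f1 f2].
have Zl (a : R) (h : R -> R) : mu.-integrable D (EFin \o h) ->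
    mu.-integrable D (EFin \o (fun t => a * h t)).
  by move=> hi; exact: (@integrableZl _ _ _ mu D mD a _ hi).
split.
  split.
    have := @integrableB _ _ _ mu D mD _ _ (Zl (complex.Re c) _ f1)
      (Zl (complex.Im c) _ f2).
    by apply: eq_integrable => // t _ /=; rewrite cReM EFinB.
  have := @integrableD _ _ _ mu D mD _ _ (Zl (complex.Re c) _ f2)
    (Zl (complex.Im c) _ f1).
  by apply: eq_integrable => // t _ /=; rewrite cImM EFinD.
apply: complex_ext => /=.
  under eq_Rintegral do rewrite cReM.
  by rewrite RintegralB//; [rewrite !RintegralZl// cReM|exact: Zl|exact: Zl].
under eq_Rintegral do rewrite cImM.
by rewrite RintegralD//; [rewrite !RintegralZl// cImM|exact: Zl|exact: Zl].
Qed.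

End ComplexIntegral.

(** * Fubini's theorem for real and complex kernels *)

Section ComplexFubini.
Context {R : realType}.
Local Notation mu := (@lebesgue_measure R).

(** Tonelli turns the integrable bound [H] on the inner integrals of [|k|] into integrability on the
    product. The last hypothesis makes the inner integrals in the other order finite for every [y],
    so that passing from extended real to real integrals is valid pointwise and not just almost
    everywhere. *)
Lemma RFubini (D1 D2 : set R) (k : R -> R -> R) (H : R -> R) :
  measurable D1 -> measurable D2 ->
  measurable_fun (D1 `*` D2) (fun p => k p.1 p.2) ->
  mu.-integrable D1 (EFin \o H) ->
  (forall x, D1 x -> (\int[mu]_(y in D2) `|k x y|%:E <= (H x)%:E)%E) ->
  (forall y, D2 y -> mu.-integrable D1 (EFin \o (fun x => k x y))) ->
  mu.-integrable D1 (EFin \o (fun x => Rintegral mu D2 (k x))) /\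
  Rintegral mu D1 (fun x => Rintegral mu D2 (k x)) =
  Rintegral mu D2 (fun y => Rintegral mu D1 (k^~ y)).
Proof.
move=> mD1 mD2 mk iH kH ky.
(* Extension by zero reduces the statement on [D1] x [D2] to Fubini on the whole plane. *)
pose f : R * R -> \bar R := (EFin \o (fun p => k p.1 p.2)) \_ (D1 `*` D2).
have fE x y : f (x, y) = if (x \in D1) && (y \in D2) then (k x y)%:E else 0%E.
  by rewrite /f patchE in_setX.
have mf : measurable_fun setT f.
  apply: (measurable_restrictT _ _).1; first exact: measurableX.
  by apply/measurable_EFinP; exact: mk.
have f1 x : (\int[mu]_y f (x, y) =
    ((fun x => \int[mu]_(y in D2) (k x y)%:E) \_ D1) x)%E.
  rewrite patchE; case: ifPn => xD1; last first.
    by apply: integral0_eq => y _; rewrite fE (negbTE xD1).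
  rewrite [RHS]integral_mkcond; apply: eq_integral => y _.
  by rewrite fE xD1 patchE.
have f2 y : (\int[mu]_x f (x, y) =
    ((fun y => \int[mu]_(x in D1) (k x y)%:E) \_ D2) y)%E.
  rewrite patchE; case: ifPn => yD2; last first.
    by apply: integral0_eq => x _; rewrite fE (negbTE yD2) andbF.
  rewrite [RHS]integral_mkcond; apply: eq_integral => x _.
  by rewrite fE yD2 andbT patchE.
pose AH x := `|H x|.
have fi : (mu \x mu)%E.-integrable setT f.
  apply/(@integrable12ltyP _ _ _ _ _ mu mu f mf).
  apply: (@le_lt_trans _ _ (\int[mu]_x ((EFin \o AH) \_ D1) x)%E).
    apply: ge0_le_integral => //.
    - by move=> x _; exact: integral_ge0.
    - exact: (@measurable_fun_fubini_tonelli_F _ _ _ _ _ mu (abse \o f)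
        (measurableT_comp (@abse_measurable R setT) mf) (fun x => abse_ge0 (f x))).
    - apply: (measurable_restrictT _ mD1).1; apply/measurable_EFinP.
      by apply: measurableT_comp => //; apply/measurable_EFinP; exact: measurable_int iH.
    move=> x _; rewrite patchE; case: ifPn => xD1; last first.
      by rewrite integral0_eq// => y _; rewrite fE (negbTE xD1) abse0.
    apply: (@le_trans _ _ (H x)%:E); last by rewrite lee_fin ler_norm.
    suff -> : (\int[mu]_y `|f (x, y)| = \int[mu]_(y in D2) `|k x y|%:E)%E.
      exact: kH (set_mem xD1).
    rewrite [RHS]integral_mkcond; apply: eq_integral => y _.
    by rewrite fE xD1 patchE; case: (y \in D2); rewrite ?abse0.
  rewrite -integral_mkcond.
  by have /integrableP[_] := iH.
have kx x : D1 x -> (\int[mu]_(y in D2) (k x y)%:E)%E \is a fin_num.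
  move=> D1x; rewrite fin_num_abs (le_lt_trans (le_abse_integral _ _ _))//.
    apply: (measurable_restrictT _ mD2).2.
    apply: eq_measurable_fun (measurable_fun_pair2 x mf) => y _.
    by rewrite fE patchE mem_set.
  by rewrite (le_lt_trans (kH x D1x))// ltry.
have iF : mu.-integrable D1 (fun x => \int[mu]_(y in D2) (k x y)%:E)%E.
  apply: (@integrable_mkcond _ _ _ mu D1 _ mD1).2.
  have := @integrable_fubini_F _ _ _ _ _ mu mu f fi.
  by apply: eq_integrable => // x _; exact: f1.
split.
  apply: eq_integrable iF => // x /set_mem D1x.
  by rewrite /= /Rintegral fineK// kx.
have FE : (\int[mu]_(x in D1) \int[mu]_(y in D2) (k x y)%:E =
    \int[mu]_(y in D2) \int[mu]_(x in D1) (k x y)%:E)%E.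
  rewrite integral_mkcond [RHS]integral_mkcond.
  transitivity (\int[mu]_x \int[mu]_y f (x, y))%E.
    by apply: eq_integral => x _; rewrite f1.
  rewrite (@Fubini _ _ _ _ _ mu mu f fi).
  by apply: eq_integral => y _; rewrite f2.
rewrite {1}/Rintegral [in RHS]/Rintegral; congr fine.
transitivity (\int[mu]_(x in D1) \int[mu]_(y in D2) (k x y)%:E)%E.
  by apply: eq_integral => x /set_mem D1x; rewrite /Rintegral fineK// kx.
rewrite FE; apply: eq_integral => y /set_mem D2y.
by rewrite /Rintegral fineK//; apply: integrable_fin_num => //; exact: ky.
Qed.

(** Real and imaginary parts are both dominated by the norm, so one [H] serves for the two. *)
Lemma CFubini (D1 D2 : set R) (k : R -> R -> R[i]) (H : R -> R) :
  measurable D1 -> measurable D2 ->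
  Cmeasurable (D1 `*` D2) (fun p => k p.1 p.2) ->
  mu.-integrable D1 (EFin \o H) ->
  (forall x, D1 x -> (\int[mu]_(y in D2) (normc (k x y))%:E <= (H x)%:E)%E) ->
  (forall y, D2 y -> Cintegrable D1 (fun x => k x y)) ->
  Cintegrable D1 (fun x => Cintegral D2 (k x)) /\
  Cintegral D1 (fun x => Cintegral D2 (k x)) =
  Cintegral D2 (fun y => Cintegral D1 (k^~ y)).
Proof.
move=> mD1 mD2 mk iH kH ky.
have kHr (g : R[i] -> R) : (forall z, `|g z| <= normc z) ->
    measurable_fun (D1 `*` D2) (fun p => g (k p.1 p.2)) ->
    forall x, D1 x -> (\int[mu]_(y in D2) `|g (k x y)|%:E <= (H x)%:E)%E.
  move=> gn mg x D1x; apply: le_trans (kH x D1x).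
  have sec (h : R -> R -> R) : measurable_fun (D1 `*` D2) (fun p => h p.1 p.2) ->
      measurable_fun D2 (h x).
    move=> mh; apply: (measurable_restrictT _ mD2).2.
    have /(measurable_fun_pair2 x) :=
      (measurable_restrictT _ (measurableX mD1 mD2)).1 mh.
    by apply: eq_measurable_fun => y _; rewrite !patchE in_setX mem_set.
  apply: ge0_le_integral => //.
  - by apply/measurable_EFinP/measurableT_comp => //; exact: (sec (fun x y => g (k x y))).
  - apply/measurable_EFinP; apply: (sec (fun x y => normc (k x y))).
    exact: measurable_normc.
  - by move=> y _; rewrite lee_fin.
have [i1 e1] := RFubini mD1 mD2 mk.1 iH (kHr _ ler_Re_normc mk.1)
  (fun y D2y => (ky y D2y).1).
have [i2 e2] := RFubini mD1 mD2 mk.2 iH (kHr _ ler_Im_normc mk.2)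
  (fun y D2y => (ky y D2y).2).
split; first by split; [exact: i1|exact: i2].
by apply: complex_ext; [exact: e1|exact: e2].
Qed.

End ComplexFubini.

(** * Laplace transform of monomials *)

Section Laplace.
Context {R : realType}.
Local Notation mu := (@lebesgue_measure R).

(** x^n / n! is one term of the exponential series. *)
Lemma exprn_le_expR (x : R) n : 0 <= x -> x ^+ n <= n`!%:R * expR x.
Proof.
move=> x0; rewrite mulrC -ler_pdivrMr ?ltr0n ?fact_gt0//.
case: n => [|n]; first by rewrite expr0 fact0 divr1 -expR0 ler_expR.
by apply: le_trans (expR_ge1Dxn n x0); rewrite lerDr.
Qed.

Lemma exprn_le_expRM (c x : R) n : 0 < c -> 0 <= x ->
  x ^+ n <= n`!%:R / c ^+ n * expR (c * x).
Proof.
move=> c0 x0; have := @exprn_le_expR (c * x) n (mulr_ge0 (ltW c0) x0).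
by rewrite exprMn mulrC -ler_pdivlMr ?exprn_gt0// mulrAC.
Qed.

Lemma is_derive_continuous (f df : R -> R) :
  (forall x : R, is_derive x (1 : R) f (df x)) -> continuous f.
Proof.
move=> h x; apply: differentiable_continuous; apply/derivable1_diffP.
by have [] := h x.
Qed.

Lemma is_derive_expRM (a x : R) :
  is_derive x (1 : R) (fun x => expR (a * x)) (a * expR (a * x)).
Proof.
rewrite [X in is_derive _ _ _ X]mulrC.
have h : is_derive x (1 : R) ( *%R a) a.
  by apply: is_derive_eq; rewrite -[RHS]mulr1.
exact: (@is_derive1_comp _ expR ( *%R a)).
Qed.

Lemma is_derive_cosM (a x : R) :
  is_derive x (1 : R) (fun x => cos (a * x)) (- (a * sin (a * x))).
Proof.
have h : is_derive x (1 : R) ( *%R a) a.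
  by apply: is_derive_eq; rewrite -[RHS]mulr1.
rewrite mulrC -mulNr.
exact: (@is_derive1_comp _ cos ( *%R a)).
Qed.

Lemma is_derive_sinM (a x : R) :
  is_derive x (1 : R) (fun x => sin (a * x)) (a * cos (a * x)).
Proof.
have h : is_derive x (1 : R) ( *%R a) a.
  by apply: is_derive_eq; rewrite -[RHS]mulr1.
rewrite mulrC.
exact: (@is_derive1_comp _ sin ( *%R a)).
Qed.

Lemma exp_decay_cvg0 (C c : R) (f : R -> R) : 0 < c ->
  (forall x, 0 <= x -> `|f x| <= C * expR (- c * x)) ->
  f x @[x --> +oo] --> (0 : R).
Proof.
move=> c0 fC; apply/cvgr0Pnorm_le => e e0.
(* [C] may be zero; a positive constant is needed to divide and to take logarithms. *)
have C0 : 0 < `|C| + 1 by rewrite ltr_wpDl.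
near=> x; have x0 : 0 <= x by near: x; apply: nbhs_pinfty_ge; rewrite num_real.
apply: le_trans (fC x x0) _.
apply: (@le_trans _ _ ((`|C| + 1) * expR (- c * x))).
  by rewrite ler_wpM2r ?expR_ge0// (le_trans (ler_norm _))// lerDl.
rewrite mulrC -ler_pdivlMr// -ler_ln ?posrE ?expR_gt0 ?divr_gt0// expRK.
rewrite mulNr lerNl -(ler_pdivrMl _ _ c0).
by near: x; apply: nbhs_pinfty_ge; rewrite num_real.
Unshelve. all: by end_near. Qed.

Lemma ge0_FTC2y (f F : R -> R) (l : R) : (forall x, 0 <= x -> 0 <= f x) ->
  continuous f -> (forall x, is_derive x (1 : R) F (f x)) ->
  F x @[x --> +oo] --> l ->
  (\int[mu]_(x in `[0%R, +oo[) (f x)%:E = (l - F 0)%:E)%E.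
Proof.
move=> f0 cf dF Fl; rewrite EFinB; apply: ge0_continuous_FTC2y => //.
- exact: continuous_subspaceT.
- by apply: cvg_at_right_filter; exact: (is_derive_continuous dF).
- by move=> x _; rewrite derive1E; exact: derive_val.
Qed.

Lemma integrable_expRN (C c : R) : 0 < c ->
  mu.-integrable `[0%R, +oo[ (EFin \o (fun x => C * expR (- c * x))).
Proof.
move=> c0.
have ce : continuous (fun x => expR (- c * x) : R).
  exact: is_derive_continuous (is_derive_expRM (- c)).
suff : mu.-integrable `[0%R, +oo[ (EFin \o (fun x => expR (- c * x))).
  by move=> h; have := @integrableZl _ _ _ mu _ (measurable_itv _) C _ h.
apply/integrableP; split.
  apply/measurable_EFinP; apply: measurable_funTS.
  exact: continuous_measurable_fun.
under eq_integral do rewrite /= ger0_norm ?expR_ge0//.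
pose E x : R := (- c)^-1 * expR (- c * x).
have dE x : is_derive x (1 : R) E (expR (- c * x)).
  have := is_deriveZ (- c)^-1 (is_derive_expRM (- c) x).
  by rewrite /GRing.scale/= mulrA mulVf ?mul1r// oppr_eq0 gt_eqF.
have E0 : E x @[x --> +oo] --> (0 : R).
  apply: (@exp_decay_cvg0 `|(- c)^-1| c) => // x _.
  by rewrite normrM (ger0_norm (expR_ge0 _)).
by rewrite (ge0_FTC2y (fun x _ => expR_ge0 (- c * x)) ce dE E0) ltry.
Qed.

(* Adding the dominating exponential reduces to nonnegative integrands. *)
Lemma dominated_FTC2y (f F : R -> R) (l C c : R) : 0 < c ->
  continuous f -> (forall x, is_derive x (1 : R) F (f x)) ->
  F x @[x --> +oo] --> l ->
  (forall x, 0 <= x -> `|f x| <= C * expR (- c * x)) ->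
  Rintegral mu `]0, +oo[ f = l - F 0.
Proof.
move=> c0 cf dF Fl fC.
have ce : continuous (fun x => C * expR (- c * x) : R).
  move=> x; apply: cvgM; first exact: cvg_cst.
  exact: is_derive_continuous (is_derive_expRM (- c)) x.
have ie := integrable_expRN C c0.
have fi : mu.-integrable `[0%R, +oo[ (EFin \o f).
  apply: le_integrable ie => //.
    by apply/measurable_EFinP/measurable_funTS; exact: continuous_measurable_fun.
  move=> x /=; rewrite in_itv/= andbT => x0.
  by rewrite lee_fin (le_trans (fC x x0))// ler_norm.
rewrite Rintegral_itv_obnd_cbnd; last first.
  by apply: integrableS fi => // x /=; rewrite !in_itv/= !andbT => /ltW.
pose E x : R := C * ((- c)^-1 * expR (- c * x)).
have dE x : is_derive x (1 : R) E (C * expR (- c * x)).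
  have := is_deriveZ C (is_deriveZ (- c)^-1 (is_derive_expRM (- c) x)).
  by rewrite /GRing.scale/= !mulrA (mulfVK (x := - c)) ?oppr_eq0 ?gt_eqF.
have E0 : E x @[x --> +oo] --> (0 : R).
  apply: (@exp_decay_cvg0 (`|C| * `|(- c)^-1|) c) => // x _.
  by rewrite /E !normrM (ger0_norm (expR_ge0 _)) mulrA.
have fe0 x : 0 <= x -> 0 <= f x + C * expR (- c * x).
  by move=> x0; rewrite -lerBlDr sub0r; have := fC x x0; rewrite ler_norml => /andP[].
have e0 x : 0 <= x -> 0 <= C * expR (- c * x).
  by move=> x0; exact: le_trans (fC x x0).
have I1 : (\int[mu]_(x in `[0%R, +oo[) (f x + C * expR (- c * x))%:E =
    (l + 0 - (F 0 + E 0))%:E)%E.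
  apply: (@ge0_FTC2y _ (fun x => F x + E x)) => //.
  - by move=> x; apply: cvgD; [exact: cf|exact: ce].
  - exact: cvgD.
have I2 := @ge0_FTC2y _ E 0 e0 ce dE E0.
transitivity (Rintegral mu `[0, +oo[ (fun x => f x + C * expR (- c * x)) -
              Rintegral mu `[0, +oo[ (fun x => C * expR (- c * x))).
  by rewrite RintegralD// addrK.
by rewrite /Rintegral I1 I2/=; lra.
Qed.

End Laplace.

(** * Laplace transform of x^n at a complex point *)

Section LaplaceMonomial.
Context {R : realType}.
Local Notation mu := (@lebesgue_measure R).

(** With [g] a cosine or a sine, these are the real and imaginary parts of the transform of x^n. *)
Let J (a : R) n (g : R -> R) : R :=
  Rintegral mu `]0, +oo[ (fun x => x ^+ n * (expR (a * x) * g x)).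

(** Half of the exponential decay is spent on absorbing x^n, the other half remains. *)
Lemma monomial_laplace_bound (c : R) n (g : R -> R) (x : R) :
  0 < c -> (forall x, `|g x| <= 1) -> 0 <= x ->
  `|x ^+ n * (expR (- c * x) * g x)| <=
    n`!%:R / (c / 2) ^+ n * expR (- (c / 2) * x).
Proof.
move=> c0 g1 x0; have c20 : 0 < c / 2 by rewrite divr_gt0.
rewrite !normrM (ger0_norm (expR_ge0 _)) ger0_norm ?exprn_ge0//.
apply: (@le_trans _ _ (n`!%:R / (c / 2) ^+ n * expR (c / 2 * x) * expR (- c * x))).
  apply: ler_pM => //; rewrite ?exprn_ge0 ?mulr_ge0 ?expR_ge0//.
    exact: exprn_le_expRM.
  by rewrite -[leRHS]mulr1 ler_wpM2l ?expR_ge0.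
rewrite -mulrA -expRD ler_wpM2l//; first by rewrite divr_ge0// exprn_ge0// ltW.
rewrite ler_expR; lra.
Qed.

Lemma monomial_laplace_integrable (c : R) n (g : R -> R) :
  0 < c -> (forall x, `|g x| <= 1) -> continuous g ->
  mu.-integrable `]0, +oo[ (EFin \o (fun x => x ^+ n * (expR (- c * x) * g x))).
Proof.
move=> c0 g1 cg; have c20 : 0 < c / 2 by rewrite divr_gt0.
have ie := integrable_expRN (n`!%:R / (c / 2) ^+ n) c20.
have {}ie : mu.-integrable `]0, +oo[
    (EFin \o (fun x => n`!%:R / (c / 2) ^+ n * expR (- (c / 2) * x))).
  by apply: integrableS ie => // x /=; rewrite !in_itv/= !andbT => /ltW.
apply: le_integrable ie => //.
  apply/measurable_EFinP/measurable_funTS; apply: continuous_measurable_fun.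
  move=> x; apply: cvgM; first exact: exprn_continuous.
  apply: cvgM; last exact: cg.
  exact: is_derive_continuous (is_derive_expRM (- c)) x.
move=> x /=; rewrite in_itv/= andbT => /ltW x0.
by rewrite lee_fin (le_trans (monomial_laplace_bound n c0 g1 x0))// ler_norm.
Qed.

(** Integration by parts: the left-hand side is the integral of the derivative of x^n exp (- c x)
    g(x), which tends to 0 at infinity, so what remains is minus the value at 0, nonzero only for n
    = 0. In that case the term with [n.-1] has coefficient 0. The cosine and the sine play the roles
    of [g] and [dg] in turn. *)
Lemma monomial_laplace_rec (c b : R) n (g dg : R -> R) : 0 < c ->
  (forall x, `|g x| <= 1) -> (forall x, `|dg x| <= 1) ->
  continuous g -> continuous dg ->
  (forall x : R, is_derive x (1 : R) g (b * dg x)) ->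
  n%:R * J (- c) n.-1 g - c * J (- c) n g + b * J (- c) n dg =
  - ((n == 0)%:R * g 0).
Proof.
move=> c0 g1 dg1 cg cdg dgE; have c20 : 0 < c / 2 by rewrite divr_gt0.
pose e k (h : R -> R) x := x ^+ k * (expR (- c * x) * h x).
have ce k (h : R -> R) : continuous h -> continuous (e k h).
  move=> ch x; apply: cvgM; first exact: exprn_continuous.
  apply: cvgM; last exact: ch.
  exact: is_derive_continuous (is_derive_expRM (- c)) x.
have ie k (h : R -> R) (h1 : forall x, `|h x| <= 1) (ch : continuous h) :
    mu.-integrable `]0, +oo[ (EFin \o e k h).
  exact: monomial_laplace_integrable.
pose K k : R := k`!%:R / (c / 2) ^+ k.
have K0 k : 0 <= K k by rewrite divr_ge0// exprn_ge0// ltW.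
pose f x : R := n%:R * e n.-1 g x - c * e n g x + b * e n dg x.
have cf : continuous f.
  move=> x; apply: cvgD.
    apply: cvgB; (apply: cvgM; first exact: cvg_cst); exact: ce.
  apply: cvgM; [exact: cvg_cst|exact: ce].
have df x : is_derive x (1 : R) (e n g) (f x).
  have h1 : is_derive x (1 : R) (fun x => x ^+ n) (n%:R * x ^+ n.-1).
    have := is_deriveX n (is_derive_id x (1 : R)).
    by rewrite exprfctE /GRing.scale/= mulr1.
  have := is_deriveM h1 (is_deriveM (is_derive_expRM (- c) x) (dgE x)).
  move=> h; apply: (is_derive_eq h); rewrite /f /e /GRing.scale/=.
  rewrite -[((fun x0 => _) * g) x]/(expR (- c * x) * g x); ring.
have -> : - ((n == 0)%:R * g 0) = 0 - e n g 0.
  by rewrite /e mulr0 expR0 mul1r sub0r expr0n.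
rewrite -(@dominated_FTC2y R f (e n g) 0
  (n%:R * K n.-1 + c * K n + `|b| * K n) (c / 2))//.
- rewrite /f.
  have iZ r k (h : R -> R) (h1 : forall x, `|h x| <= 1) (ch : continuous h) :
      mu.-integrable `]0, +oo[ (EFin \o (fun x => r * e k h x)).
    exact: (@integrableZl _ _ _ mu _ (measurable_itv _) r _ (ie k h h1 ch)).
  rewrite RintegralD//; last 2 first.
  - have := @integrableB _ _ _ mu _ (measurable_itv _) _ _
      (iZ n%:R n.-1 g g1 cg) (iZ c n g g1 cg).
    by apply: eq_integrable => // t _ /=; rewrite EFinB.
  - exact: iZ.
  by rewrite RintegralB ?RintegralZl//; first [exact: ie | exact: iZ].
- apply: (@exp_decay_cvg0 _ (K n) (c / 2)) => // x x0.
  exact: monomial_laplace_bound.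
- move=> x x0; rewrite !mulrDl (le_trans (ler_normD _ _))// lerD//; last first.
    rewrite normrM -mulrA ler_wpM2l//; exact: monomial_laplace_bound.
  rewrite (le_trans (ler_normB _ _))// lerD// normrM.
    rewrite (ger0_norm (ler0n _ _)) -mulrA ler_wpM2l//.
    exact: monomial_laplace_bound.
  rewrite (gtr0_norm c0) -mulrA ler_wpM2l ?(ltW c0)//.
  exact: monomial_laplace_bound.
Qed.

Lemma cexpE (w : R[i]) : cexp w =
  (expR (complex.Re w) * cos (complex.Im w)) +i*
  (expR (complex.Re w) * sin (complex.Im w)).
Proof. by apply: complex_ext; rewrite /cexp ?cReM ?cImM /= mul0r ?subr0 ?addr0. Qed.

Lemma normc_cexp (w : R[i]) : normc (cexp w) = expR (complex.Re w).
Proof.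
by rewrite /cexp ComplexField.Normc.normcM normc_real /= cos2Dsin2 sqrtr1 mulr1
  ger0_norm ?expR_ge0.
Qed.

Lemma cexpMr (w : R[i]) (x : R) : cexp (w * x%:C) =
  (expR (complex.Re w * x) * cos (complex.Im w * x)) +i*
  (expR (complex.Re w * x) * sin (complex.Im w * x)).
Proof. by rewrite cexpE cReM cImM /= !mulr0 subr0 add0r. Qed.

Lemma real_complexX (x : R) n : x%:C ^+ n = (x ^+ n)%:C.
Proof. by rewrite rmorphXn. Qed.

(** Writing L(n) for the integral, the recurrences for cosine and sine are the real and imaginary
    parts of s L(n+1) = (n+1) L(n), with s L(0) = 1. Real integration by parts thus replaces a
    rotation of the contour. *)
Lemma laplace_monomial (s : R[i]) n : 0 < complex.Re s ->
  Cintegrable `]0, +oo[ (fun x : R => cexp (- s * x%:C) * x%:C ^+ n) /\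
  Cintegral `]0, +oo[ (fun x : R => cexp (- s * x%:C) * x%:C ^+ n) =
  n`!%:R / s ^+ n.+1.
Proof.
(* The sign of [b] gives exp (- s x) = exp (- c x) (cos (b x) + i sin (b x)). *)
move=> s0; set c := complex.Re s in s0; pose b := - complex.Im s.
pose C x : R := cos (b * x); pose S x : R := sin (b * x).
have fE (x : R) k : cexp (- s * x%:C) * x%:C ^+ k =
    (x ^+ k * (expR (- c * x) * C x)) +i* (x ^+ k * (expR (- c * x) * S x)).
  rewrite cexpMr real_complexX cReN cImN mulrC.
  by apply: complex_ext; rewrite ?cReM ?cImM /= mul0r ?subr0 ?addr0.
have C1 x : `|C x| <= 1 by rewrite ler_norml cos_geN1 cos_le1.
have S1 x : `|S x| <= 1 by rewrite ler_norml sin_geN1 sin_le1.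
have dC (x : R) : is_derive x (1 : R) C (- b * S x).
  by rewrite mulNr; exact: is_derive_cosM.
have dS (x : R) : is_derive x (1 : R) S (b * C x) by exact: is_derive_sinM.
have cC : continuous C by exact: is_derive_continuous dC.
have cS : continuous S by exact: is_derive_continuous dS.
split.
  split.
    have := monomial_laplace_integrable n s0 C1 cC.
    by apply: eq_integrable => // x _ /=; rewrite fE.
  have := monomial_laplace_integrable n s0 S1 cS.
  by apply: eq_integrable => // x _ /=; rewrite fE.
have recC k := monomial_laplace_rec k s0 C1 S1 cC cS dC.
have recS k := monomial_laplace_rec k s0 S1 C1 cS cC dS.
have C0 : C 0 = 1 by rewrite /C mulr0 cos0.
have S0 : S 0 = 0 by rewrite /S mulr0 sin0.
have sE : s = c +i* (- b) by rewrite /c /b opprK; case: (s).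
have sn0 : s != 0 by rewrite sE eq_complex /= negb_and gt_eqF.
pose L k : R[i] := J (- c) k C +i* J (- c) k S.
have -> : Cintegral `]0, +oo[ (fun x : R => cexp (- s * x%:C) * x%:C ^+ n) = L n.
  by apply: complex_ext => /=; apply: eq_Rintegral => x _; rewrite fE.
have L0 : s * L 0 = 1.
  rewrite sE; have := recC 0; have := recS 0.
  rewrite C0 S0 eqxx !mul0r mulr0 mulr1 !add0r oppr0 /= => hS hC.
  by apply: complex_ext; rewrite ?cReM ?cImM /=; lra.
have LS k : s * L k.+1 = k.+1%:R * L k.
  rewrite sE; have := recC k.+1; have := recS k.+1.
  rewrite C0 S0 /= !mul0r oppr0 => hS hC.
  have -> : (k.+1%:R : R[i]) = k.+1%:R%:C by rewrite rmorph_nat.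
  by apply: complex_ext; rewrite ?cReM ?cImM /=; lra.
elim: n => [|n ih]; first by rewrite expr1 fact0 mul1r -(mulKf sn0 (L 0)) L0 mulr1.
rewrite -[LHS](mulKf sn0) LS ih factS natrM [in RHS]exprS invfM.
by rewrite mulrCA -[in RHS]mulrA; congr (_ * _); rewrite mulrCA.
Qed.

End LaplaceMonomial.

(** * Powers, Gamma at positive integers, and the extra parameter 1 *)

Section SpecialValues.
Context {R : realType}.
Implicit Types (t : R) (w z : R[i]).

Lemma real_complex_nat n : (n%:R : R[i]) = n%:R%:C.
Proof. by rewrite rmorph_nat. Qed.

Lemma cexpD w z : cexp (w + z) = cexp w * cexp z.
Proof.
rewrite !cexpE cReD cImD expRD cosD sinD.
by apply: complex_ext; rewrite ?cReM ?cImM /=; ring.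
Qed.

Lemma cexp_real t : cexp t%:C = (expR t)%:C.
Proof. by rewrite cexpE /= cos0 sin0 mulr1 mulr0. Qed.

Lemma rcpowD t w z : rcpow t (w + z) = rcpow t w * rcpow t z.
Proof. by rewrite /rcpow mulrDl cexpD. Qed.

Lemma rcpow_nat t n : 0 < t -> rcpow t n%:R = (t ^+ n)%:C.
Proof.
move=> t0; rewrite /rcpow real_complex_nat -rmorphM cexp_real expRM_natl.
by rewrite lnK ?posrE.
Qed.

Lemma normc_rcpow t w : 0 < t -> normc (rcpow t w) = t `^ complex.Re w.
Proof.
move=> t0; rewrite /rcpow normc_cexp cReM /= mulr0 subr0.
by rewrite /powR gt_eqF.
Qed.

(** Euler's integral at 1 + n is the Laplace transform of t^n at s = 1. *)
Lemma Gamma_nat n : Gamma (1 + n%:R) = n`!%:R :> R[i].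
Proof.
rewrite /Gamma cReD real_complex_nat /= ltr_wpDr// /Gamma_integral.
have := @laplace_monomial R 1 n ltr01 => -[_]; rewrite expr1n divr1 => <-.
apply: eq_Cintegral => t; rewrite inE/= in_itv/= andbT => t0.
rewrite [1 + _]addrC addrK -real_complex_nat rcpow_nat// real_complexX mulrC.
by rewrite mulN1r -rmorphN cexp_real.
Qed.

Lemma pochhammer1 n : pochhammer 1 n = n`!%:R :> R[i].
Proof.
rewrite /pochhammer; case: eqP => [->//|_].
by rewrite Gamma_nat -[X in Gamma X]addr0 (Gamma_nat 0) divr1.
Qed.

(** As (1)_n = n!, the appended parameter contributes exactly the factorial that the Laplace
    transform of rho^n produces. *)
Lemma Mseries_term_rcons1 p q (alpha beta : R[i]) (kappa : p.-tuple R[i])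
    (mu : q.-tuple R[i]) z n :
  Mseries_term alpha beta [tuple of rcons kappa 1] mu z n =
  n`!%:R * Mseries_term alpha beta kappa mu z n.
Proof.
have last : tnth [tuple of rcons kappa 1] ord_max = 1.
  by rewrite (tnth_nth 1) /= nth_rcons size_tuple ltnn eqxx.
have init (i : 'I_p) : tnth [tuple of rcons kappa 1] (widen_ord (leqnSn p) i) =
    tnth kappa i.
  by rewrite (tnth_nth 1) /= nth_rcons size_tuple ltn_ord -tnth_nth.
have poch_eq (u v : R[i]) : u = v -> pochhammer u n = pochhammer v n by move->.
have E : \prod_(i < p.+1) pochhammer (tnth [tuple of rcons kappa 1] i) n =
    (\prod_(i < p) pochhammer (tnth kappa i) n) * n`!%:R.
  rewrite big_ord_recr; apply: congr2.
    apply: eq_bigr => i _.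
    apply: poch_eq.
    exact: init.
  transitivity (pochhammer (1 : R[i]) n); last exact: pochhammer1.
  by apply: poch_eq.
by rewrite /Mseries_term E -!mulrA mulrCA.
Qed.

End SpecialValues.

(** * Entire series *)

Section EntireSeries.
Context {R : realType}.
Local Notation mu := (@lebesgue_measure R).

Lemma Cseries_sumZl (c : R[i]) (u : nat -> R[i]) : Cseries_cvg u ->
  Cseries_sum (fun k => c * u k) = c * Cseries_sum u.
Proof.
move=> cu.
have ccu : (series (fun k => c * u k) : nat -> R[i]^o) @ \oo -->
    (c * Cseries_sum u : R[i]^o).
  rewrite (_ : series _ = (fun n => c * series u n)); last first.
    by apply/funext => n; rewrite /series/= mulr_sumr.
  by apply: cvgM; [exact: cvg_cst|exact: cu].
by rewrite {1}/Cseries_sum (cvg_lim (@norm_hausdorff _ _) ccu).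
Qed.

Lemma abs_Cseries_cvg (u : nat -> R[i]) (K : R) :
  (forall n, \sum_(0 <= k < n) normc (u k) <= K) -> Cseries_cvg u.
Proof.
by move=> uK; apply/cvg_ex; exists (Cseries_sum u); have [] := abs_cvg_Cseries uK.
Qed.

Lemma sum_half_pow_le2 n : \sum_(0 <= k < n) (2^-1 : R) ^+ k <= 2.
Proof.
have -> : \sum_(0 <= k < n) (2^-1 : R) ^+ k = 2 - 2 * 2^-1 ^+ n.
  elim: n => [|n ih]; first by rewrite big_nil expr0 mulr1 subrr.
  by rewrite big_nat_recr//= ih exprS; lra.
by rewrite lerBlDr lerDl mulr_ge0// exprn_ge0.
Qed.

(** The doubled radius leaves a geometric series of ratio 1/2, whose partial sums are at most 2. *)
Lemma bounded_terms_sum_le (c : nat -> R) (r B : R) : (forall k, 0 <= c k) ->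
  0 <= r -> (forall k, c k * (2 * r) ^+ k <= B) ->
  forall n, \sum_(0 <= k < n) c k * r ^+ k <= B * 2.
Proof.
move=> c0 r0 cB n.
have B0 : 0 <= B by apply: le_trans (cB 0); rewrite mulr_ge0// exprn_ge0// mulr_ge0.
apply: (@le_trans _ _ (\sum_(0 <= k < n) B * 2^-1 ^+ k)).
  apply: ler_sum => k _; rewrite exprVn ler_pdivlMr ?exprn_gt0//.
  by rewrite -mulrA -exprMn [r * 2]mulrC.
by rewrite -mulr_sumr ler_wpM2l// sum_half_pow_le2.
Qed.

Lemma continuous_sqrt_sum_sqr (f g : R -> R) : continuous f -> continuous g ->
  continuous (fun x => Num.sqrt (f x ^+ 2 + g x ^+ 2)).
Proof.
move=> cf cg.
rewrite (_ : (fun x => _) = Num.sqrt \o (fun x => f x * f x + g x * g x)).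
  move=> x; apply: continuous_comp; last exact: sqrt_continuous.
  by apply: cvgD; apply: cvgM; [exact: cf|exact: cf|exact: cg|exact: cg].
by apply/funext => x; rewrite /= !expr2.
Qed.

(** Continuity is deduced from differentiability: a power series is differentiable at x when it and
    its first two formal derivatives converge at some point beyond |x|. *)
Lemma continuous_entire_pseries (b : nat -> R) :
  (forall r, 0 <= r -> exists B, forall k, `|b k| * r ^+ k <= B) ->
  continuous (fun x : R => limn (series (fun k => b k * x ^+ k))).
Proof.
move=> hb.
(* Formal differentiation preserves the bounds at all radii: k + 1 <= 2^(k+1) and r^k <= (r +
   1)^(k+1), hence the radius 2 (r + 1). *)
have hd (c : nat -> R) :
    (forall r, 0 <= r -> exists B, forall k, `|c k| * r ^+ k <= B) ->
    forall r, 0 <= r -> exists B, forall k, `|pseries_diffs c k| * r ^+ k <= B.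
  move=> hc r r0.
  have [B cB] := hc (2 * (r + 1)) (mulr_ge0 (ler0n _ _) (addr_ge0 r0 ler01)).
  exists B => k; apply: le_trans (cB k.+1).
  rewrite /pseries_diffs normrM (ger0_norm (ler0n _ _)) mulrC mulrA [leRHS]mulrC.
  rewrite ler_wpM2r// exprMn mulrC ler_pM ?exprn_ge0//.
    by rewrite -natrX ler_nat ltnW// ltn_expl.
  rewrite exprS -[leLHS]mul1r ler_pM ?exprn_ge0//; first by rewrite lerDr.
  by rewrite lerXn2r ?nnegrE ?addr_ge0// lerDl.
have cvgb (c : nat -> R) (K : R) :
    (forall r, 0 <= r -> exists B, forall k, `|c k| * r ^+ k <= B) ->
    cvgn (pseries c K).
  move=> hc; have [B cB] := hc (2 * `|K|) (mulr_ge0 (ler0n _ _) (normr_ge0 _)).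
  apply: (@cvg_series_bounded_norm _ _ (B * 2)) => n.
  under eq_bigr do rewrite normrM normrX.
  exact: bounded_terms_sum_le.
move=> x; apply: differentiable_continuous; apply/derivable1_diffP.
have h : `|x| < `| `|x| + 1 |.
  by rewrite [ltRHS]ger0_norm ?addr_ge0// ltrDl.
by have [] := pseries_snd_diffs (cvgb _ _ hb) (cvgb _ _ (hd _ hb))
  (cvgb _ _ (hd _ (hd _ hb))) h.
Qed.

Section Entire.
Variable a : nat -> R[i].
Hypothesis ha : forall r, 0 <= r -> exists K, forall n,
  \sum_(0 <= k < n) normc (a k) * k`!%:R * r ^+ k <= K.

(** A real argument suffices: the left-hand M-series is evaluated at - rho/(t (1 - t)). *)
Definition entire_sum (x : R) : R[i] := Cseries_sum (fun k => a k * x%:C ^+ k).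

Lemma entire_term_norm (x : R) k :
  normc (a k * x%:C ^+ k) = normc (a k) * `|x| ^+ k.
Proof. by rewrite ComplexField.Normc.normcM normcX normc_real. Qed.

(** By |x|^k <= k! c^(-k) exp (c |x|), the sum is at most exp (c |x|) times the sum of k! |a_k|
    c^(-k), which [ha] bounds at radius 1/c. *)
Lemma entire_sum_bound (c : R) : 0 < c -> exists2 K, 0 <= K &
  forall x n, \sum_(0 <= k < n) normc (a k * x%:C ^+ k) <= K * expR (c * `|x|).
Proof.
move=> c0; have [K hK] := ha (ltW (divr_gt0 ltr01 c0)).
exists K; first by have := hK 0; rewrite big_nil.
move=> x n; apply: le_trans (ler_wpM2r (expR_ge0 _) (hK n)).
rewrite mulr_suml; apply: ler_sum => k _; rewrite entire_term_norm -!mulrA.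
rewrite ler_wpM2l ?normc_ge0// mulrA (le_trans (exprn_le_expRM k c0 (normr_ge0 x)))//.
by rewrite div1r exprVn.
Qed.

Lemma normc_entire_sum (c : R) : 0 < c -> exists2 K, 0 <= K &
  forall x, normc (entire_sum x) <= K * expR (c * `|x|).
Proof.
move=> /entire_sum_bound[K K0 hK]; exists K => // x.
by apply: normc_Cseries_sum => n; exact: hK.
Qed.

Lemma entire_sumE (x : R) : entire_sum x =
  limn (series (fun k => complex.Re (a k) * x ^+ k)) +i*
  limn (series (fun k => complex.Im (a k) * x ^+ k)).
Proof.
have [K _ hK] := entire_sum_bound ltr01.
have [_] := abs_cvg_Cseries (hK x); rewrite /entire_sum => ->.
congr (limn (series _) +i* limn (series _)); apply/funext => k.
  by rewrite real_complexX cReM /= mulr0 subr0.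
by rewrite real_complexX cImM /= mulr0 add0r.
Qed.

(** Continuity serves both for the measurability of the integrands and for the boundedness of the
    M-series on compact intervals. *)
Lemma continuous_entire_sum :
  continuous (fun x => complex.Re (entire_sum x)) /\
  continuous (fun x => complex.Im (entire_sum x)).
Proof.
have hg (g : R[i] -> R) : (forall w, `|g w| <= normc w) ->
    forall r, 0 <= r -> exists B, forall k, `|g (a k)| * r ^+ k <= B.
  move=> gn r r0; have [K hK] := ha r0; exists K => k.
  apply: le_trans (hK k.+1); rewrite big_nat_recr//=.
  rewrite -[leLHS]add0r lerD//.
    by apply: sumr_ge0 => i _; rewrite !mulr_ge0 ?normc_ge0 ?exprn_ge0.
  rewrite ler_wpM2r ?exprn_ge0// (le_trans (gn _))// -[leLHS]mulr1.
  by rewrite ler_wpM2l ?normc_ge0// ler1n fact_gt0.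
split.
  rewrite (_ : (fun x => _) =
    (fun x => limn (series (fun k => complex.Re (a k) * x ^+ k)))).
    exact: continuous_entire_pseries (hg _ ler_Re_normc).
  by apply/funext => x; rewrite entire_sumE.
rewrite (_ : (fun x => _) =
  (fun x => limn (series (fun k => complex.Im (a k) * x ^+ k)))).
  exact: continuous_entire_pseries (hg _ ler_Im_normc).
by apply/funext => x; rewrite entire_sumE.
Qed.

Lemma Cmeasurable_entire_sum d (T : measurableType d) (D : set T) (f : T -> R) :
  measurable_fun D f -> Cmeasurable D (fun t => entire_sum (f t)).
Proof.
move=> mf; have [c1 c2] := continuous_entire_sum; split.
  apply: (measurableT_comp (f := fun x => complex.Re (entire_sum x))) => //.
  exact: continuous_measurable_fun.
apply: (measurableT_comp (f := fun x => complex.Im (entire_sum x))) => //.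
exact: continuous_measurable_fun.
Qed.

Lemma continuous_normc_entire_sum : continuous (fun x => normc (entire_sum x)).
Proof.
have [c1 c2] := continuous_entire_sum.
rewrite (_ : (fun x => _) = (fun x => Num.sqrt (complex.Re (entire_sum x) ^+ 2 +
  complex.Im (entire_sum x) ^+ 2))); last first.
  by apply/funext => x; case: (entire_sum x).
exact: continuous_sqrt_sum_sqr c1 c2.
Qed.

Lemma laplace_entire_sum (s : R[i]) (u : R) : 0 < complex.Re s ->
  Cintegrable `]0, +oo[ (fun x => cexp (- s * x%:C) * entire_sum (x * u)) /\
  Cintegral `]0, +oo[ (fun x => cexp (- s * x%:C) * entire_sum (x * u)) =
  1 / s * Cseries_sum (fun k => k`!%:R * a k * (u%:C / s) ^+ k).
Proof.
move=> s0; have s20 : 0 < complex.Re s / 2 by rewrite divr_gt0.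
have u0 : 0 < `|u| + 1 by rewrite ltr_wpDl.
(* With this rate the series at x u grows at most like exp (Re s x / 2), which leaves half of the
   decay of exp (- s x). The denominator is |u| + 1 because [u] may be zero. *)
have [K K0 hK] := entire_sum_bound (divr_gt0 s20 u0).
pose g k (x : R) : R[i] := cexp (- s * x%:C) * (a k * (x * u)%:C ^+ k).
have gE k (x : R) : g k x = (a k * u%:C ^+ k) * (cexp (- s * x%:C) * x%:C ^+ k).
  rewrite /g rmorphM exprMn; ring.
have sg (x : R) : Cseries_sum (g^~ x) = cexp (- s * x%:C) * entire_sum (x * u).
  exact: Cseries_sumZl (abs_Cseries_cvg (hK _)).
have mD : measurable (`]0%R, +oo[ : set R) by exact: measurable_itv.
have ie : mu.-integrable `]0, +oo[
    (EFin \o (fun x => K * expR (- (complex.Re s / 2) * x))).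
  apply: integrableS (integrable_expRN K s20) => // x /=.
  by rewrite !in_itv/= !andbT => /ltW.
have [|n x|i1 i2 i3] := @Cintegral_series R `]0, +oo[ g
    (fun x => K * expR (- (complex.Re s / 2) * x)) mD _ ie.
- move=> k; apply: CmeasurableM.
    apply: Cmeasurable_cexp; apply: CmeasurableM; first exact: Cmeasurable_cst.
    exact: Cmeasurable_real.
  apply: CmeasurableM; first exact: Cmeasurable_cst.
  apply: CmeasurableX; apply: Cmeasurable_real.
  by apply: measurable_funM => //; exact: measurable_cst.
- rewrite /= in_itv/= andbT => x0.
  under eq_bigr do rewrite /g ComplexField.Normc.normcM normc_cexp.
  rewrite -mulr_sumr (le_trans (ler_wpM2l (expR_ge0 _) (hK _ _)))//.
  rewrite mulrCA ler_wpM2l// -expRD ler_expR cReM cReN /= mulr0 subr0.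
  rewrite normrM (gtr0_norm x0).
  have : complex.Re s / 2 / (`|u| + 1) * (x * `|u|) <= complex.Re s / 2 * x.
    rewrite mulrACA -[leRHS]mulr1.
    rewrite ler_wpM2l ?(mulr_ge0 (ltW s20) (ltW x0))// [_^-1 * _]mulrC.
    by rewrite ler_pdivrMr// mul1r lerDl.
  move: (complex.Re s / 2) (splitr (complex.Re s)) => c -> ; lra.
(* At radius |u| / |s|, [ha] is the absolute convergence of the transformed series, from which 1/s
   is then factored out. *)
have [KS hKS] := ha (divr_ge0 (normr_ge0 u) (normc_ge0 s)).
split; first by apply: eq_Cintegrable i2 => // x _; exact: sg.
rewrite -(eq_Cintegral (fun x _ => sg x)) i3 -Cseries_sumZl; last first.
  apply: (@abs_Cseries_cvg _ KS) => n; apply: le_trans (hKS n); apply: ler_sum => k _.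
  rewrite !ComplexField.Normc.normcM normcX ComplexField.Normc.normcM
    ComplexField.Normc.normcV normc_real real_complex_nat normc_real.
  by rewrite (ger0_norm (ler0n _ _)) [_ * normc (a k)]mulrC.
congr Cseries_sum; apply/funext => k.
have [j1 j2] := laplace_monomial k s0.
rewrite (eq_Cintegral (fun x _ => gE k x)) (CintegralZl _ mD j1).2 j2.
rewrite exprMn exprVn exprS invfM; ring.
Qed.

End Entire.

End EntireSeries.

(** * Dilation bounds for beta-type integrals *)

Section Substitution.
Context {R : realType}.
Local Notation mu := (@lebesgue_measure R).

Lemma measurable_onem :
  measurable_fun setT
  ((fun x => 1 - x) : measurableTypeR R -> measurableTypeR R).
Proof. by apply: measurable_funB => //; exact: measurable_cst. Qed.

(** Lebesgue measure is determined by its values on half-open intervals, and reflection swaps the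
    open and the closed end without changing the length. *)
Lemma lebesgue_measure_onem (A : set R) : measurable A ->
  pushforward mu
    ((fun x => 1 - x) : measurableTypeR R -> measurableTypeR R) A = mu A.
Proof.
move=> mA; apply/esym/lebesgue_measure_unique => //=; first exact: measurable_onem.
move=> _ _ [[a b]] _ <-.
rewrite /pushforward.
have -> : (fun x => 1 - x) @^-1` [set` Interval (BRight a) (BRight b)] =
    [set` Interval (BLeft (1 - b)) (BLeft (1 - a))].
  apply/seteqP; split => x /=; rewrite !in_itv/= => /andP[h1 h2]; apply/andP; split; lra.
rewrite !lebesgue_measure_itv/= !lte_fin ltrD2l ltrN2.
by case: ifP => // _; rewrite -!EFinD; congr (_%:E); lra.
Qed.

Lemma ge0_integral_onem (D : set R) (f : R -> \bar R) : measurable D ->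
  measurable_fun D f -> (forall x, D x -> (0 <= f x)%E) ->
  (\int[mu]_(x in D) f x =
   \int[mu]_(x in (fun x => 1 - x)%R @^-1` D) f (1 - x)%R)%E.
Proof.
move=> mD mf f0.
rewrite -(@ge0_integral_pushforward _ _ _ _ _ _ measurable_onem mu D f)//.
  apply: eq_measure_integral; first exact: measurable_onem.
  by move=> ? A mA AS; exact/esym/lebesgue_measure_onem.
by move=> x /set_mem; exact: f0.
Qed.

(* Substitution is only available on bounded closed intervals: exhaust ]0, b] by
   the intervals [b / n, b]. *)
Lemma ge0_integration_by_substitution_oc (F k : R -> R) (b : R) : 0 < b ->
  (forall t, 0 < t -> derivable F t 1) ->
  (forall t, 0 < t -> {for t, continuous F^`()%classic}) ->
  {in `]0, b] &, {homo F : x y / x < y}} ->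
  (forall t, 0 < t <= b -> 0 <= F^`()%classic t) ->
  (forall t, 0 < t <= b -> 0 < F t) ->
  F t @[t --> 0^'+] --> 0 ->
  (forall v, 0 < v -> {for v, continuous k}) ->
  (forall v, 0 <= k v) ->
  (\int[mu]_(v in `]0%R, F b]) (k v)%:E =
   \int[mu]_(t in `]0%R, b]) (k (F t) * F^`()%classic t)%:E)%E.
Proof.
move=> b0 dF cdF incF dF0 Fp F0 ck k0.
pose e n := b / n.+1%:R.
have e0 n : 0 < e n by rewrite divr_gt0.
have eb n : e n <= b by rewrite ler_pdivrMr// ler_peMr ?(ltW b0)// ler1n.
have e_itv n : e n \in `]0, b] by rewrite in_itv/= e0 eb.
have b_itv : b \in `]0, b] by rewrite in_itv/= b0 lexx.
have ehomo n m : (n <= m)%N -> e m <= e n.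
  by move=> nm; rewrite ler_wpM2l ?(ltW b0)// lef_pV2 ?posrE// ler_nat.
have nF : {in `]0, b] &, {homo F : x y / x <= y}}.
  move=> x y xb yb; rewrite le_eqVlt => /predU1P[->//|xy].
  exact/ltW/incF.
have cF t : 0 < t -> {for t, continuous F}.
  by move=> t0; apply: differentiable_continuous; exact/derivable1_diffP/dF.
have ecvg x : 0 < x -> exists n, e n < x.
  move=> x0; exists (Num.truncn (b / x)).
  rewrite ltr_pdivrMr// -ltr_pdivrMl// mulrC.
  by rewrite (le_lt_trans _ (truncnS_gt _)).
have Fe n : 0 < F (e n) by apply: Fp; rewrite e0 eb.
have bigA : \bigcup_n `[e n, b]%classic = `]0, b]%classic.
  apply/seteqP; split => [x [n _]|x] /=; rewrite !in_itv/=.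
    by move=> /andP[ex ->]; rewrite (lt_le_trans (e0 n)).
  move=> /andP[x0 xb]; have [n en] := ecvg x x0.
  by exists n => //=; rewrite in_itv/= xb (ltW en).
(* This is where the limit of [F] at 0 enters: F (e n) falls below any given x > 0. *)
have bigB : \bigcup_n `[F (e n), F b]%classic = `]0, F b]%classic.
  apply/seteqP; split => [x [n _]|x] /=; rewrite !in_itv/=.
    by move=> /andP[ex ->]; rewrite (lt_le_trans (Fe n)).
  move=> /andP[x0 xb].
  move/cvgrPdist_lt : F0 => /(_ x x0); rewrite near_withinE => -[d /= d0 hd].
  have [n en] := ecvg d d0.
  exists n => //=; rewrite in_itv/= xb andbT ltW//.
  have := hd (e n); rewrite /ball_/= !sub0r !normrN !gtr0_norm//.
  by apply.
have within (h : R -> R) (x y : R) : 0 < x ->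
    (forall t, 0 < t <= y -> {for t, continuous h}) ->
    {within `[x, y], continuous h}.
  move=> x0 ch; apply: continuous_in_subspaceT => t.
  rewrite inE/= in_itv/= => /andP[xt ty].
  by apply: ch; rewrite ty (lt_le_trans x0 xt).
pose q t := k (F t) * F^`()%classic t.
have cq t : 0 < t <= b -> {for t, continuous q}.
  move=> /andP[t0 tb]; apply: cvgM; last exact: cdF.
  apply: (@continuous_comp _ _ _ F k); [exact: cF|by apply: ck; apply: Fp; rewrite t0].
have L : (\int[mu]_(v in `[F (e n), F b]) (k v)%:E)%E @[n --> \oo] -->
    (\int[mu]_(v in `]0%R, F b]) (k v)%:E)%E.
  rewrite -bigB; apply: ge0_nondecreasing_set_cvg_integral.
  - move=> n m nm; apply/subsetPset => x /=; rewrite !in_itv/= => /andP[h ->].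
    by rewrite andbT (le_trans _ h)// nF// ehomo.
  - by move=> n; exact: measurable_itv.
  - move=> n; apply/measurable_EFinP; apply: subspace_continuous_measurable_fun => //.
    by apply: within => // t /andP[t0 _]; exact: ck.
  - by move=> n x _; rewrite lee_fin.
have Rr : (\int[mu]_(t in `[e n, b]) (q t)%:E)%E @[n --> \oo] -->
    (\int[mu]_(t in `]0%R, b]) (q t)%:E)%E.
  rewrite -bigA; apply: ge0_nondecreasing_set_cvg_integral.
  - move=> n m nm; apply/subsetPset => x /=; rewrite !in_itv/= => /andP[h ->].
    by rewrite andbT (le_trans _ h)// ehomo.
  - by move=> n; exact: measurable_itv.
  - move=> n; apply/measurable_EFinP; apply: subspace_continuous_measurable_fun => //.
    exact: within.
  - move=> n x /=; rewrite in_itv/= => /andP[ex xb]; rewrite lee_fin mulr_ge0// dF0//.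
    by rewrite xb (lt_le_trans (e0 n)).
rewrite -(cvg_lim _ L)// -(cvg_lim _ Rr)//; congr (limn _); apply/funext => n.
apply: integration_by_substitution_increasing.
- exact: eb.
- move=> x y; rewrite !in_itv/= => /andP[x1 x2] /andP[y1 y2]; apply: incF;
    rewrite in_itv/= ?x2 ?y2 andbT; exact: lt_le_trans (e0 n) _.
- by move=> x; rewrite in_itv/= => /andP[ex _]; apply: cdF; exact: lt_trans ex.
- by apply/cvg_ex; exists (F^`()%classic (e n)); apply: cvg_at_right_filter; exact: cdF.
- by apply/cvg_ex; exists (F^`()%classic b); apply: cvg_at_left_filter; exact: cdF.
- split.
  + by move=> x; rewrite in_itv/= => /andP[ex _]; apply: dF; exact: lt_trans ex.
  + by apply: cvg_at_right_filter; exact: cF.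
  + by apply: cvg_at_left_filter; exact: cF.
- by apply: within => // t /andP[t0 _]; exact: ck.
Qed.

End Substitution.

(** * Scaling of the integral near t = 0 *)

Section Dilation.
Context {R : realType}.
Local Notation mu := (@lebesgue_measure R).

(** On nonnegative reals, 0 included, the inverse is the power with exponent -1, and powers are
    measurable. *)
Lemma measurable_funV_ge0 d (T : measurableType d) (D : set T) (f : T -> R) :
  measurable_fun D f -> (forall x, D x -> 0 <= f x) ->
  measurable_fun D (fun x => (f x)^-1).
Proof.
move=> mf f0; apply: (@eq_measurable_fun _ _ _ _ _ (fun x => f x `^ (-1))).
  by move=> x /set_mem Dx; rewrite powR_inv1// f0.
by apply: (measurableT_comp (f := (@powR R)^~ (-1))) => //; exact: measurable_powR.
Qed.

Lemma continuous_powRl (p t : R) : 0 < t -> {for t, continuous (fun x => x `^ p)}.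
Proof.
move=> t0; apply: differentiable_continuous; apply/derivable1_diffP.
by apply: derivable_powR; rewrite in_itv/= t0.
Qed.

(** The substitution v = t^X turns the constant 1 into X t^(X - 1), so X times the integral equals
    1. *)
Lemma integral_powR_lty (X : R) : 0 < X ->
  (\int[mu]_(t in `]0%R, 1%R]) (t `^ (X - 1))%:E < +oo)%E.
Proof.
move=> X0.
pose F t : R := t `^ X.
have dFE t : 0 < t -> F^`()%classic t = X * t `^ (X - 1).
  by move=> t0; apply: powR_derive1; rewrite in_itv/= t0.
have := @ge0_integration_by_substitution_oc R F (cst 1) 1 ltr01.
have -> : F 1 = 1 by rewrite /F powR1.
move=> sub.
have {sub} : (\int[mu]_(v in `]0%R, 1%R]) (cst 1 v)%:E =
   \int[mu]_(t in `]0%R, 1%R]) (cst 1 (F t) * F^`()%classic t)%:E)%E.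
  apply: sub.
  - by move=> t t0; apply: derivable_powR; rewrite in_itv/= t0.
  - move=> t t0.
    suff : F^`()%classic x @[x --> t] --> X * t `^ (X - 1).
      by rewrite -(dFE t t0).
    apply: (@cvg_trans _ ((fun x => X * x `^ (X - 1)) @ t)).
      apply: near_eq_cvg; near=> x; rewrite dFE//.
      by near: x; exact: lt_nbhsr.
    have : X * x `^ (X - 1) @[x --> t] --> X * t `^ (X - 1).
      by apply: cvgM; [exact: cvg_cst|exact: continuous_powRl].
    by [].
  - move=> x y; rewrite !in_itv/= => /andP[x0 _] /andP[y0 _] xy.
    by apply: gt0_ltr_powR; rewrite ?nnegrE ?ltW.
  - by move=> t /andP[t0 _]; rewrite dFE// mulr_ge0 ?powR_ge0 ?ltW.
  - by move=> t /andP[t0 _]; exact: powR_gt0.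
  - exact: powR_cvg0.
  - by move=> v _; exact: cvg_cst.
  - by move=> v.
have -> : (\int[mu]_(t in `]0%R, 1%R]) (cst 1 (F t) * F^`()%classic t)%:E =
    X%:E * \int[mu]_(t in `]0%R, 1%R]) (t `^ (X - 1))%:E)%E.
  rewrite -ge0_integralZl_EFin//.
  - by apply: eq_integral => t; rewrite inE/= in_itv/= => /andP[t0 _];
      rewrite mul1r dFE.
  - by move=> t _; rewrite lee_fin powR_ge0.
  - by apply/measurable_EFinP/measurable_funTS; exact: measurable_powR.
  - exact: ltW.
have -> : (\int[mu]_(v in `]0%R, 1%R]) (cst 1%R v)%:E = 1)%E.
  transitivity (\int[mu]_(v in `]0%R, 1%R]) cst 1 v)%E => //.
  rewrite integral_cst; last exact: measurable_itv.
  rewrite mul1e; have := @lebesgue_measure_itv R `]0, 1] => /= ->.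
  by rewrite lte_fin ltr01 oppr0 adde0.
set J := (\int[mu]_(t in _) _)%E => XJ; rewrite ltNge leye_eq.
by apply/eqP => J_; move: XJ; rewrite J_ gt0_muley// lte_fin.
Unshelve. all: by end_near. Qed.

(** Away from 0 a power is comparable to a constant, here [A] = 4^|p|. The range [1/4, 1] contains 1
    - t for t <= 1/4, and both t and 1 - t between 1/4 and 3/4. *)
Lemma powR_bounds (p : R) : exists2 A, 0 < A &
  forall s, 4^-1 <= s <= 1 -> 1 <= A * s `^ p /\ s `^ p <= A.
Proof.
pose L : R := - ln (4^-1).
exists (expR (`|p| * L)); first exact: expR_gt0.
move=> s /andP[s34 s1]; have s0 : 0 < s by lra.
have lns0 : ln s <= 0 by exact: ln_le0.
have lnsL : - L <= ln s by rewrite opprK ler_ln ?posrE//; lra.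
have pL : `|p * ln s| <= `|p| * L.
  by rewrite normrM ler_wpM2l// ler0_norm// lerNl.
have [pL1 pL2] : - (`|p| * L) <= p * ln s /\ p * ln s <= `|p| * L.
  by move: pL; rewrite ler_norml => /andP.
rewrite /powR gt_eqF// -expRD -expR0 !ler_expR; split => //; lra.
Qed.

(* The substitution w = t (1 - t) / r turns the integral for r into r^X times an
   integral of w^(X - 1) h(1/w) over ]0, 3/(16 r)]; since h(1/w) vanishes for
   w >= 3/16, the latter is at most the integral over ]0, 3/16], whatever r. *)
Lemma near0_dilation (X : R) (h : R -> R) : 0 < X -> continuous h ->
  (forall v, 0 <= h v) -> (forall v, 0 <= v <= 16 / 3 -> h v = 0) ->
  (\int[mu]_(t in `]0%R, (4^-1)%R]) (t `^ (X - 1) * h (1 / (t * (1 - t))))%:E < +oo)%E ->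
  exists2 C, 0 <= C & forall r, 0 < r ->
  (\int[mu]_(t in `]0%R, (4^-1)%R]) (t `^ (X - 1) * h (r / (t * (1 - t))))%:E <=
   (C * r `^ X)%:E)%E.
Proof.
move=> X0 ch h0 hz hfin; set p := X - 1.
have [A A0 hA] := powR_bounds p.
(* The integrand in the new variable w = F r t. *)
pose k v : R := v `^ p * h v^-1.
have k0 v : 0 <= k v by rewrite mulr_ge0// powR_ge0.
have ck v : 0 < v -> {for v, continuous k}.
  move=> v0; apply: cvgM; first exact: continuous_powRl.
  have cV : {for v, continuous (fun v : R => v^-1)}.
    by apply: cvgV; [rewrite gt_eqF|exact: cvg_id].
  exact: (@continuous_comp _ _ _ (fun v : R => v^-1) h v cV (ch _)).
have mk (D : set R) : measurable D -> (forall v, D v -> 0 < v) -> measurable_fun D k.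
  move=> mD D0; apply: measurable_funM.
    by apply: measurable_funTS; exact: measurable_powR.
  apply: (measurableT_comp (f := h)); first exact: continuous_measurable_fun.
  by apply: measurable_funV_ge0 => // v /D0/ltW.
pose F r t : R := t * (1 - t) / r.
have dF r t : is_derive t (1 : R) (F r) ((1 - t *+ 2) / r).
  rewrite /F; apply: is_derive_eq; rewrite /GRing.scale/=; lra.
have FE r : (F r)^`()%classic = fun t => (1 - t *+ 2) / r.
  by apply/funext => t; rewrite derive1E; exact: derive_val.
have sub r : 0 < r -> (\int[mu]_(v in `]0%R, F r (4^-1)%R]) (k v)%:E =
    \int[mu]_(t in `]0%R, (4^-1)%R]) (k (F r t) * ((1 - t *+ 2) / r))%:E)%E.
  move=> r0.
  rewrite (@ge0_integration_by_substitution_oc R (F r) k 4^-1)//.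
  - by apply: eq_integral => t _; rewrite FE.
  - move=> t _; rewrite FE; apply: cvgM; last exact: cvg_cst.
    by apply: cvgB; [exact: cvg_cst|exact: cvgMn].
  - move=> x y; rewrite !in_itv/= => /andP[x0 x4] /andP[y0 y4] xy.
    rewrite /F ltr_pM2r ?invr_gt0// -subr_gt0.
    have -> : y * (1 - y) - x * (1 - x) = (y - x) * (1 - (x + y)) by ring.
    by rewrite mulr_gt0; lra.
  - by move=> t /andP[t0 t4]; rewrite FE divr_ge0 ?(ltW r0)//; lra.
  - by move=> t /andP[t0 t4]; rewrite divr_gt0 ?mulr_gt0//; lra.
  - apply: cvg_at_right_filter.
    have F00 : F r 0 = 0 by rewrite /F !mul0r.
    have : F r t @[t --> 0] --> F r 0 by exact: (is_derive_continuous (dF r)).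
    by rewrite F00.
pose J := (\int[mu]_(v in `]0%R, (3 / 16)%R]) (k v)%:E)%E.
have J0 : (0 <= J)%E by apply: integral_ge0 => v _; rewrite lee_fin.
have kJ b : (\int[mu]_(v in `]0%R, b]) (k v)%:E <= J)%E.
  rewrite /J integral_mkcond [leRHS]integral_mkcond; apply: ge0_le_integral => //.
  - by move=> v _; rewrite patchE; case: ifP => // _; rewrite lee_fin.
  - apply: (measurable_restrictT _ (measurable_itv _)).1; apply/measurable_EFinP.
    by apply: mk => // v; rewrite /= in_itv/= => /andP[].
  - apply: (measurable_restrictT _ (measurable_itv _)).1; apply/measurable_EFinP.
    by apply: mk => // v; rewrite /= in_itv/= => /andP[].
  move=> v _; rewrite !patchE; case: ifPn => [|_]; last first.
    by case: ifP => // _; rewrite lee_fin.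
  rewrite inE/= in_itv/= => /andP[v0 _]; case: ifPn => //.
  rewrite notin_setE/= in_itv/= v0/= => /negP; rewrite -ltNge => v316.
  rewrite /k hz ?mulr0// invr_ge0 (ltW v0)/=.
  by rewrite invf_ple ?posrE//; lra.
(* For t <= 1/4 the derivative 1 - 2 t of t (1 - t) lies between 1/2 and 1: the Jacobian can be
   inserted at the cost of a factor 2, and dropped for free. *)
have phiE (t : R) : 0 < t <= 4^-1 -> [/\ 0 < t * (1 - t), 4^-1 <= 1 - t <= 1,
    1 <= 2 * (1 - t *+ 2), 0 <= 1 - t *+ 2 & 1 - t *+ 2 <= 1].
  by move=> /andP[t0 t4]; split; rewrite ?mulr_gt0//; lra.
have mq r : 0 < r -> measurable_fun (`]0, 4^-1]%classic : set R)
    (fun t => t `^ p * h (r / (t * (1 - t)))).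
  move=> r0; apply: measurable_funM.
    by apply: measurable_funTS; exact: measurable_powR.
  apply: (measurableT_comp (f := h)); first exact: continuous_measurable_fun.
  apply: measurable_funM; first exact: measurable_cst.
  apply: measurable_funV_ge0.
    by apply: measurable_funM => //; apply: measurable_funB => //; exact: measurable_cst.
  by move=> t /=; rewrite in_itv/= => /phiE[/ltW].
have mkF r : 0 < r -> measurable_fun (`]0, 4^-1]%classic : set R)
    (fun t => k (F r t) * ((1 - t *+ 2) / r)).
  move=> r0; apply: measurable_funM; last first.
    apply: measurable_funM; last exact: measurable_cst.
    apply: measurable_funB; first exact: measurable_cst.
    by apply: measurable_funTS; apply: continuous_measurable_fun => x; exact: cvgMn.
  have mF : measurable_fun (`]0, 4^-1]%classic : set R) (F r).
    apply: measurable_funM; last exact: measurable_cst.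
    by apply: measurable_funM => //; apply: measurable_funB => //; exact: measurable_cst.
  apply: measurable_funM.
    by apply: (measurableT_comp (f := (@powR R)^~ p)) => //; exact: measurable_powR.
  apply: (measurableT_comp (f := h)); first exact: continuous_measurable_fun.
  apply: measurable_funV_ge0 => // t /=; rewrite in_itv/= => /phiE[t0 _ _ _ _].
  by rewrite divr_ge0 ?ltW.
have kFE r t : 0 < r -> 0 < t <= 4^-1 ->
    k (F r t) * r `^ p = t `^ p * (1 - t) `^ p * h (r / (t * (1 - t))).
  move=> r0 tt; have [phi0 t34 _ _ _] := phiE t tt; have /andP[t0 _] := tt.
  have E : F r t `^ p * r `^ p = t `^ p * (1 - t) `^ p.
    rewrite -[LHS]powRM ?divr_ge0 ?(ltW phi0) ?(ltW r0)// /F divfK ?gt_eqF//.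
    by rewrite powRM ?(ltW t0)//; lra.
  by rewrite /k mulrAC E /F invf_div.
(* The hypothesis is the case r = 1, where the range of w is exactly ]0, 3/16]; [A] absorbs (1 -
   t)^p. *)
have Jfin : (J < +oo)%E.
  have F1 : F 1 4^-1 = 3 / 16 by rewrite /F; lra.
  rewrite /J -F1 sub//.
  apply: (@le_lt_trans _ _ (A%:E *
      \int[mu]_(t in `]0%R, (4^-1)%R]) (t `^ p * h (1 / (t * (1 - t))))%:E)%E).
    rewrite -ge0_integralZl_EFin ?(ltW A0)//; last 2 first.
    - by move=> t _; rewrite lee_fin mulr_ge0// powR_ge0.
    - by apply/measurable_EFinP; exact: mq.
    apply: ge0_le_integral => //.
    - move=> t /=; rewrite in_itv/= => /phiE[_ _ _ t0 _].
      by rewrite lee_fin mulr_ge0// divr1.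
    - by apply/measurable_EFinP; exact: mkF.
    - by apply/measurable_EFinP; apply: measurable_funM => //; exact: mq.
    move=> t /=; rewrite in_itv/= => tt; have [phi0 t34 _ t20 t21] := phiE t tt.
    rewrite lee_fin; have := kFE 1 t ltr01 tt; rewrite powR1 mulr1 => ->.
    have [_ hAt] := hA _ t34.
    rewrite divr1 (@le_trans _ _ (t `^ p * (1 - t) `^ p * h (1 / (t * (1 - t)))))//.
      by rewrite -[leRHS]mulr1 ler_wpM2l// !mulr_ge0 ?powR_ge0.
    rewrite [A * _]mulrCA -mulrA ler_wpM2l ?powR_ge0// ler_wpM2r//.
  by rewrite lte_mul_pinfty// lee_fin ltW.
have Jfn : J \is a fin_num by rewrite ge0_fin_numE.
(* The factor 2 pays for the Jacobian and [A] for the power of 1 - t. *)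
exists (2 * A * fine J); first by rewrite !mulr_ge0 ?(ltW A0)// fine_ge0.
move=> r r0.
have c0 : 0 <= 2 * A * r `^ X by rewrite !mulr_ge0 ?powR_ge0// ltW.
apply: (@le_trans _ _ ((2 * A * r `^ X)%:E *
    \int[mu]_(t in `]0%R, (4^-1)%R]) (k (F r t) * ((1 - t *+ 2) / r))%:E)%E); last first.
  have -> : 2 * A * fine J * r `^ X = 2 * A * r `^ X * fine J by ring.
  rewrite -sub// [leRHS]EFinM fineK//.
  by rewrite lee_wpmul2l ?lee_fin.
rewrite -ge0_integralZl_EFin//; last 2 first.
- move=> t /=; rewrite in_itv/= => /phiE[_ _ _ t0 _].
  by rewrite lee_fin mulr_ge0// divr_ge0// ltW.
- by apply/measurable_EFinP; exact: mkF.
apply: ge0_le_integral => //.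
- by move=> t _; rewrite lee_fin mulr_ge0// powR_ge0.
- by apply/measurable_EFinP; exact: mq.
- by apply/measurable_EFinP; apply: measurable_funM => //; exact: mkF.
move=> t /=; rewrite in_itv/= => tt; have [phi0 t34 t2 t20 t21] := phiE t tt.
rewrite lee_fin.
(* r^p comes from the homogeneity of the power, the remaining factor r from the Jacobian. *)
have rX : r `^ X = r * r `^ p by rewrite mulr_powRB1 ?ltW.
have -> : 2 * A * r `^ X * (k (F r t) * ((1 - t *+ 2) / r)) =
    (2 * (1 - t *+ 2)) * (A * (k (F r t) * r `^ p)).
  by rewrite rX; field; rewrite gt_eqF.
rewrite kFE//; have [hAt _] := hA _ t34.
have -> : A * (t `^ p * (1 - t) `^ p * h (r / (t * (1 - t)))) =
    (A * (1 - t) `^ p) * (t `^ p * h (r / (t * (1 - t)))) by ring.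
set q := t `^ p * _; have q0 : 0 <= q by rewrite mulr_ge0// powR_ge0.
rewrite mulrA -[leLHS]mul1r ler_wpM2r//.
by rewrite -[leLHS]mulr1 ler_pM.
Qed.

End Dilation.

(** * Exponential bound for the whole interval ]0, 1[ *)

Section BetaDilation.
Context {R : realType}.
Local Notation mu := (@lebesgue_measure R).

(** Apply ln x <= x to x = r c / X; the constant is (X / c)^X. *)
Lemma powR_le_expR (X c : R) : 0 < X -> 0 < c -> exists2 C, 0 <= C &
  forall r, 0 < r -> r `^ X <= C * expR (c * r).
Proof.
move=> X0 c0; exists (expR (X * ln (X / c))); first exact: expR_ge0.
move=> r r0; rewrite /powR gt_eqF// -expRD ler_expR.
have e0 : 0 < r * c / X by rewrite divr_gt0// mulr_gt0.
have -> : ln r = ln (r * c / X) + ln (X / c).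
  by rewrite -lnM ?posrE ?e0 ?divr_gt0//; congr (ln _); field; rewrite !gt_eqF.
rewrite mulrDr addrC lerD2l.
rewrite -ler_pdivlMl// (le_trans (ltW (ln_sublinear e0)))//.
by rewrite le_eqVlt; apply/orP; left; apply/eqP; field; rewrite !gt_eqF.
Qed.

Lemma measurable_beta_weight (X Y r : R) (g : R -> R) (D : set R) :
  D `<=` `]0, 1[ -> continuous g ->
  measurable_fun D (fun t => t `^ X * (1 - t) `^ Y * g (r / (t * (1 - t)))).
Proof.
move=> D01 cg.
have m1 : measurable_fun D (fun t : R => 1 - t).
  by apply: measurable_funB => //; exact: measurable_cst.
apply: measurable_funM.
  apply: measurable_funM.
    by apply: measurable_funTS; exact: measurable_powR.
  by apply: (measurableT_comp (f := (@powR R)^~ Y)) => //; exact: measurable_powR.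
apply: (measurableT_comp (f := g)); first exact: continuous_measurable_fun.
apply: measurable_funM; first exact: measurable_cst.
apply: measurable_funV_ge0; first exact: measurable_funM.
move=> t /D01; rewrite /= in_itv/= => /andP[t0 t1].
by apply: mulr_ge0; lra.
Qed.

(* g is bounded on [0, 16/3] by some M; the excess h = max(g - M, 0) vanishes
   there, which is what near0_dilation needs. *)
Lemma half_beta_dilation (X Y c : R) (g : R -> R) : 0 < X -> 0 < c ->
  continuous g -> (forall v, 0 <= g v) ->
  (\int[mu]_(t in `]0%R, (4^-1)%R])
    (t `^ (X - 1) * (1 - t) `^ (Y - 1) * g (1 / (t * (1 - t))))%:E < +oo)%E ->
  exists2 C, 0 <= C & forall r, 0 < r ->
  (\int[mu]_(t in `]0%R, (4^-1)%R])
    (t `^ (X - 1) * (1 - t) `^ (Y - 1) * g (r / (t * (1 - t))))%:E <=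
    (C * expR (c * r))%:E)%E.
Proof.
move=> X0 c0 cg g0 gfin.
have [A A0 hA] := powR_bounds (Y - 1).
have [M M0 gM] : exists2 M, 0 <= M & forall v, 0 <= v <= 16 / 3 -> g v <= M.
  have h16 : (0 : R) <= 16 / 3 by rewrite divr_ge0.
  have [m _ hm] := EVT_max h16 (continuous_subspaceT cg).
  exists (g m) => // v v16; apply: hm; by rewrite in_itv.
pose h v := (g v - M + `|g v - M|) / 2.
have ch : continuous h.
  move=> v; apply: cvgM; last exact: cvg_cst.
  have cgM : {for v, continuous (fun v => g v - M)}.
    by apply: cvgB; [exact: cg|exact: cvg_cst].
  by apply: cvgD; [exact: cgM|exact: cvg_norm].
have hE v : 0 <= h v /\ h v <= g v /\ g v <= M + h v.
  by rewrite /h; have := g0 v; case: (ger0P (g v - M)) => *; split; [|split| |split]; lra.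
have h0 v : 0 <= h v by have [] := hE v.
have hz v : 0 <= v <= 16 / 3 -> h v = 0.
  move=> /gM; rewrite -subr_le0 => gv; rewrite /h ler0_norm//; lra.
have itvP (t : R) : 0 < t <= 4^-1 -> 4^-1 <= 1 - t <= 1.
  by move=> /andP[t0 t4]; apply/andP; split; lra.
have sub01 : (`]0, 4^-1]%classic : set R) `<=` `]0, 1[.
  move=> t /=; rewrite !in_itv/= => /andP[-> t4]/=; lra.
have mw r (f : R -> R) : continuous f -> measurable_fun (`]0, 4^-1]%classic : set R)
    (fun t => t `^ (X - 1) * (1 - t) `^ (Y - 1) * f (r / (t * (1 - t)))).
  exact: measurable_beta_weight.
have mh r (f : R -> R) : continuous f -> measurable_fun (`]0, 4^-1]%classic : set R)
    (fun t => t `^ (X - 1) * f (r / (t * (1 - t)))).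
  move=> /(measurable_beta_weight (X - 1) 0 r sub01).
  by apply: eq_measurable_fun => t _; rewrite powRr0 mulr1.
(* The truncated function inherits finiteness at r = 1 from h <= g and 1 <= A (1 - t)^(Y - 1). *)
have hfin : (\int[mu]_(t in `]0%R, (4^-1)%R])
    (t `^ (X - 1) * h (1 / (t * (1 - t))))%:E < +oo)%E.
  apply: (@le_lt_trans _ _ (A%:E * \int[mu]_(t in `]0%R, (4^-1)%R])
    (t `^ (X - 1) * (1 - t) `^ (Y - 1) * g (1 / (t * (1 - t))))%:E)%E); last first.
    by rewrite lte_mul_pinfty// lee_fin ltW.
  rewrite -ge0_integralZl_EFin ?(ltW A0)//; last 2 first.
  - by move=> t _; rewrite lee_fin !mulr_ge0// powR_ge0.
  - by apply/measurable_EFinP; exact: mw.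
  apply: ge0_le_integral => //.
  - by move=> t _; rewrite lee_fin mulr_ge0// powR_ge0.
  - by apply/measurable_EFinP; exact: mh.
  - apply/measurable_EFinP; apply: measurable_funM; first exact: measurable_cst.
    exact: mw.
  move=> t /=; rewrite in_itv/= => /itvP/hA[A1 _].
  set v := 1 / _; rewrite lee_fin.
  have -> : A * (t `^ (X - 1) * (1 - t) `^ (Y - 1) * g v) =
      t `^ (X - 1) * (A * (1 - t) `^ (Y - 1) * g v) by ring.
  rewrite ler_wpM2l ?powR_ge0// -[leLHS]mul1r ler_pM//.
  by have [_ []] := hE v.
have [C1 C10 hC1] := near0_dilation X0 ch h0 hz hfin.
have [C2 C20 hC2] := powR_le_expR X0 c0.
pose J := (\int[mu]_(t in `]0%R, (4^-1)%R]) (t `^ (X - 1))%:E)%E.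
have Jfin : J \is a fin_num.
  rewrite ge0_fin_numE; last by apply: integral_ge0 => t _; rewrite lee_fin powR_ge0.
  apply: le_lt_trans (integral_powR_lty X0); apply: ge0_subset_integral => //.
  - by apply/measurable_EFinP/measurable_funTS; exact: measurable_powR.
  - by move=> t _; rewrite lee_fin powR_ge0.
  - by move=> t /=; rewrite !in_itv/= => /andP[-> t4]/=; lra.
have J0 : 0 <= fine J.
  by apply: fine_ge0; apply: integral_ge0 => t _; rewrite lee_fin powR_ge0.
(* From g <= M + h: the constant [M] contributes [M * fine J] for every r, and [h] at most C1 r^X <=
   C1 C2 exp (c r); [A] bounds (1 - t)^(Y - 1). *)
exists (A * (M * fine J + C1 * C2)).
  by rewrite mulr_ge0 ?addr_ge0 ?mulr_ge0// ltW.
move=> r r0.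
apply: (@le_trans _ _ (A%:E * (M%:E * J + \int[mu]_(t in `]0%R, (4^-1)%R])
    (t `^ (X - 1) * h (r / (t * (1 - t))))%:E))%E); last first.
  rewrite -[J]fineK// -mulrA [leRHS]EFinM lee_pmul2l//.
  apply: (@le_trans _ _ ((M * fine J)%:E + (C1 * r `^ X)%:E)%E).
    by rewrite leeD2l// hC1.
  rewrite -EFinD lee_fin mulrDl lerD//.
    rewrite -[leLHS]mulr1 ler_wpM2l ?mulr_ge0// -expR0 ler_expR mulr_ge0// ltW//.
  by rewrite -mulrA ler_wpM2l// hC2.
rewrite -ge0_integralZl_EFin//; last 2 first.
- by move=> t _; rewrite lee_fin powR_ge0.
- by apply/measurable_EFinP/measurable_funTS; exact: measurable_powR.
rewrite -ge0_integralD//; last 4 first.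
- by move=> t _; rewrite -EFinM lee_fin mulr_ge0// powR_ge0.
- apply/measurable_EFinP; apply: measurable_funM; first exact: measurable_cst.
  by apply: measurable_funTS; exact: measurable_powR.
- by move=> t _; rewrite lee_fin mulr_ge0// powR_ge0.
- by apply/measurable_EFinP; exact: mh.
rewrite -ge0_integralZl_EFin ?(ltW A0)//; last 2 first.
- by move=> t _; rewrite -EFinM -EFinD lee_fin addr_ge0// mulr_ge0// powR_ge0.
- apply: emeasurable_funD; last by apply/measurable_EFinP; exact: mh.
  apply/measurable_EFinP; apply: measurable_funM; first exact: measurable_cst.
  by apply: measurable_funTS; exact: measurable_powR.
apply: ge0_le_integral => //.
- by move=> t _; rewrite lee_fin !mulr_ge0// powR_ge0.
- by apply/measurable_EFinP; exact: mw.
- apply/measurable_EFinP; apply: measurable_funM; first exact: measurable_cst.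
  apply: measurable_funD; last exact: mh.
  apply: measurable_funM; first exact: measurable_cst.
  by apply: measurable_funTS; exact: measurable_powR.
move=> t /=; rewrite in_itv/= => /itvP/hA[_ A1].
set v := r / _.
rewrite -[leRHS]/((A * (M * t `^ (X - 1) + t `^ (X - 1) * h v))%:E) lee_fin.
have -> : A * (M * t `^ (X - 1) + t `^ (X - 1) * h v) =
  t `^ (X - 1) * (A * (M + h v)) by ring.
rewrite -mulrA ler_wpM2l ?powR_ge0// ler_pM ?powR_ge0//.
by have [_ []] := hE v.
Qed.

(** The scaling estimate handles ]0, 1/4], and also [3/4, 1[ after the reflection t -> 1 - t, which
    exchanges X and Y and preserves t (1 - t). Between them the growth hypothesis on [g]
    suffices. *)
Lemma beta_dilation_bound (X Y c : R) (g : R -> R) : 0 < X -> 0 < Y -> 0 < c ->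
  continuous g -> (forall v, 0 <= g v) ->
  (forall d, 0 < d -> exists2 K, 0 <= K & forall v, g v <= K * expR (d * `|v|)) ->
  (\int[mu]_(t in `]0%R, 1%R[)
    (t `^ (X - 1) * (1 - t) `^ (Y - 1) * g (1 / (t * (1 - t))))%:E < +oo)%E ->
  exists2 C, 0 <= C & forall r, 0 < r ->
  (\int[mu]_(t in `]0%R, 1%R[)
    (t `^ (X - 1) * (1 - t) `^ (Y - 1) * g (r / (t * (1 - t))))%:E <=
    (C * expR (c * r))%:E)%E.
Proof.
move=> X0 Y0 c0 cg g0 gexp gfin.
pose w x y r t : R := t `^ (x - 1) * (1 - t) `^ (y - 1) * g (r / (t * (1 - t))).
have w0 x y r t : 0 <= w x y r t by rewrite !mulr_ge0// powR_ge0.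
have mw x y r (D : set R) : D `<=` `]0, 1[ -> measurable_fun D (w x y r).
  by move=> D01; exact: measurable_beta_weight.
have sub1 : (`]0, 4^-1]%classic : set R) `<=` `]0, 1[.
  by move=> t /=; rewrite !in_itv/= => /andP[-> t4]/=; lra.
have sub2 : (`]4^-1, 3 / 4[%classic : set R) `<=` `]0, 1[.
  by move=> t /=; rewrite !in_itv/= => /andP[t1 t2]; apply/andP; split; lra.
have sub3 : (`[3 / 4, 1[%classic : set R) `<=` `]0, 1[.
  by move=> t /=; rewrite !in_itv/= => /andP[t1 t2]; apply/andP; split; lra.
have refl r : (\int[mu]_(t in `[(3 / 4)%R, 1%R[) (w X Y r t)%:E =
    \int[mu]_(t in `]0%R, (4^-1)%R]) (w Y X r t)%:E)%E.
  rewrite ge0_integral_onem//; last 2 first.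
  - by apply/measurable_EFinP; exact: mw.
  - by move=> t _; rewrite lee_fin.
  have -> : (fun x => 1 - x) @^-1` (`[3 / 4, 1[%classic : set R) = `]0, 4^-1]%classic.
    by apply/seteqP; split => t /=; rewrite !in_itv/= => /andP[? ?];
      apply/andP; split; lra.
  apply: eq_integral => t _; rewrite /w; have -> : 1 - (1 - t) = t by ring.
  by rewrite [(1 - t) * t]mulrC [(1 - t) `^ _ * _]mulrC.
have [C1 C10 hC1] : exists2 C, 0 <= C & forall r, 0 < r ->
    (\int[mu]_(t in `]0%R, (4^-1)%R]) (w X Y r t)%:E <= (C * expR (c * r))%:E)%E.
  apply: half_beta_dilation => //.
  apply: le_lt_trans gfin; apply: ge0_subset_integral => //.
  - by apply/measurable_EFinP; exact: (mw X Y).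
  - by move=> t _; rewrite lee_fin; exact: (w0 X Y).
have [C3 C30 hC3] : exists2 C, 0 <= C & forall r, 0 < r ->
    (\int[mu]_(t in `]0%R, (4^-1)%R]) (w Y X r t)%:E <= (C * expR (c * r))%:E)%E.
  apply: half_beta_dilation => //; rewrite -(refl 1).
  apply: le_lt_trans gfin; apply: ge0_subset_integral => //.
  - by apply/measurable_EFinP; exact: (mw X Y).
  - by move=> t _; rewrite lee_fin; exact: (w0 X Y).
have [A1 A10 hA1] := powR_bounds (X - 1).
have [A2 A20 hA2] := powR_bounds (Y - 1).
(* Between 1/4 and 3/4 one has t (1 - t) >= 3/16, so growth at rate 3 c / 16 in r/(t (1 - t)) is
   growth at rate at most c in r. *)
have c160 : 0 < c * (3 / 16) by rewrite mulr_gt0// divr_gt0.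
have [K K0 hK] := gexp _ c160.
pose C2 := A1 * A2 * K.
have C20 : 0 <= C2 by rewrite !mulr_ge0// ltW.
have hC2 r : 0 < r ->
    (\int[mu]_(t in `](4^-1)%R, (3 / 4)%R[) (w X Y r t)%:E <= (C2 * expR (c * r))%:E)%E.
  move=> r0.
  apply: (@le_trans _ _ (\int[mu]_(t in `](4^-1)%R, (3 / 4)%R[)
      (cst (C2 * expR (c * r))%:E t))%E).
    apply: ge0_le_integral => //.
    - by move=> t _; rewrite lee_fin.
    - by apply/measurable_EFinP; exact: mw.
    move=> t /=; rewrite in_itv/= => /andP[t1 t2]; rewrite lee_fin /w /C2 -mulrA.
    have [_ a1] : 1 <= A1 * t `^ (X - 1) /\ t `^ (X - 1) <= A1.
      by apply: hA1; apply/andP; split; lra.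
    have [_ a2] : 1 <= A2 * (1 - t) `^ (Y - 1) /\ (1 - t) `^ (Y - 1) <= A2.
      by apply: hA2; apply/andP; split; lra.
    rewrite [leRHS](_ : _ = A1 * (A2 * (K * expR (c * r)))); last by rewrite !mulrA.
    rewrite ler_pM ?mulr_ge0 ?powR_ge0// ler_pM ?powR_ge0//.
    rewrite (le_trans (hK _))// ler_wpM2l// ler_expR.
    have phi : 3 / 16 <= t * (1 - t).
      (* The product expands to t (1 - t) - 3/16. *)
      have : 0 <= (t - 4^-1) * (3 / 4 - t) by rewrite mulr_ge0; lra.
      lra.
    have phi0 : 0 < t * (1 - t) by apply: lt_le_trans phi; rewrite divr_gt0.
    rewrite (ger0_norm (divr_ge0 (ltW r0) (ltW phi0))) -mulrA ler_wpM2l ?(ltW c0)//.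
    by rewrite mulrCA -[leRHS]mulr1 ler_wpM2l ?(ltW r0)// ler_pdivrMr// mul1r.
  rewrite integral_cst; last exact: measurable_itv.
  rewrite -[leRHS]mule1 lee_wpmul2l ?lee_fin ?(mulr_ge0 C20 (expR_ge0 _))//.
  have mle : (mu (`](4^-1)%R, (3 / 4)%R[%classic : set R) <= 1)%E.
    rewrite lebesgue_measure_itv/=; case: ifP => _; last by rewrite lee_fin.
    by rewrite -EFinD lee_fin; lra.
  exact: mle.
exists (C1 + C2 + C3); first by rewrite !addr_ge0.
move=> r r0.
have U1 : (`]0, 1[%classic : set R) =
    (`]0, 4^-1] `|` `]4^-1, 3 / 4[) `|` `[3 / 4, 1[.
  apply/seteqP; split => t /=; rewrite !in_itv/=.
    move=> /andP[-> ->]; rewrite andbT/=.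
    case: (leP t 4^-1) => ?; first by left; left.
    by case: (ltP t (3 / 4)) => ?; [left; right|right].
  by move=> [[/andP[? ?]|/andP[? ?]]|/andP[? ?]]; apply/andP; split; lra.
rewrite -/(w X Y r _) U1.
have disj1 : [disjoint ((`]0, 4^-1] `|` `]4^-1, 3 / 4[) : set R) &
    (`[3 / 4, 1[ : set R)]%classic.
  apply/disj_setPS => t /= [[|]]; rewrite !in_itv/= => /andP[? ?] /andP[? ?]; lra.
have disj2 : [disjoint (`]0, 4^-1] : set R) & (`]4^-1, 3 / 4[ : set R)]%classic.
  apply/disj_setPS => t /= []; rewrite !in_itv/= => /andP[? ?] /andP[? ?]; lra.
have mE (D : set R) : D `<=` `]0, 1[ -> measurable_fun D (fun t => (w X Y r t)%:E).
  by move=> D01; apply/measurable_EFinP; exact: mw.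
rewrite (@ge0_integral_setU _ _ _ mu _ _ _ _ (fun t => (w X Y r t)%:E))//; last 3 first.
- exact: measurableU.
- by apply: mE; rewrite -U1.
- by move=> t _; rewrite lee_fin.
rewrite (@ge0_integral_setU _ _ _ mu _ _ _ _ (fun t => (w X Y r t)%:E))//; last 2 first.
- by apply: mE => t [/sub1|/sub2].
- by move=> t _; rewrite lee_fin.
have -> : (C1 + C2 + C3) * expR (c * r) =
  C1 * expR (c * r) + C2 * expR (c * r) + C3 * expR (c * r) by ring.
rewrite refl !EFinD; apply: leeD; last exact: hC3.
by apply: leeD; [exact: hC1|exact: hC2].
Qed.

End BetaDilation.

(** * The Laplace transform of the M-confluent hypergeometric function *)

Section Assembly.
Context {R : realType}.
Local Notation mu := (@lebesgue_measure R).

Lemma sum_exp_coeff_le (x : R) n : 0 <= x ->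
  \sum_(0 <= k < n) x ^+ k / k`!%:R <= expR x.
Proof.
move=> x0; have nd : {homo series (exp_coeff x) : n m / (n <= m)%N >-> n <= m}.
  by apply: nondecreasing_series => k _ _; rewrite divr_ge0// exprn_ge0.
exact: nondecreasing_cvgn_le nd (is_cvg_series_exp_coeff x) n.
Qed.

Lemma Cintegrable_measurable (D : set R) (f : R -> R[i]) :
  Cintegrable D f -> Cmeasurable D f.
Proof.
by move=> [/measurable_int f1 /measurable_int f2]; split; exact/measurable_EFinP.
Qed.

(** Componentwise integrability is absolute integrability, since |f| <= |Re f| + |Im f|; the
    convergence of the M-beta integral enters the estimates in this form. *)
Lemma Cintegrable_normc (D : set R) (f : R -> R[i]) : measurable D ->
  Cintegrable D f -> mu.-integrable D (EFin \o (fun t => normc (f t))).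
Proof.
move=> mD fi; have [f1 f2] := fi.
have := @integrableD _ _ _ mu D mD _ _ (integrable_norm f1) (integrable_norm f2).
apply: le_integrable => //.
  by apply/measurable_EFinP; exact: measurable_normc (Cintegrable_measurable fi).
move=> t Dt /=; rewrite lee_fin (ger0_norm (normc_ge0 _)).
by rewrite (le_trans (normc_le _))// ler_norm.
Qed.

(** The factor 2 comes from estimating the real and imaginary parts separately; it is harmless, as
    any constant will do. *)
Lemma normc_Cintegral (D : set R) (f : R -> R[i]) (K : R) : measurable D ->
  Cintegrable D f -> (\int[mu]_(t in D) (normc (f t))%:E <= K%:E)%E ->
  normc (Cintegral D f) <= 2 * K.
Proof.
move=> mD fi fK; have [f1 f2] := fi.
have iN := Cintegrable_normc mD fi.
have NK : Rintegral mu D (fun t => normc (f t)) <= K.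
  rewrite -lee_fin /Rintegral fineK//.
  exact: (@integrable_fin_num _ _ _ mu D mD _ iN).
rewrite (le_trans (normc_le _))// mulr2n mulrDl mul1r lerD//=.
  rewrite (le_trans (@le_normr_Rintegral _ _ _ mu D _ mD f1))// (le_trans _ NK)//.
  apply: le_Rintegral => //; first exact: integrable_norm.
  by move=> t _; exact: ler_Re_normc.
rewrite (le_trans (@le_normr_Rintegral _ _ _ mu D _ mD f2))// (le_trans _ NK)//.
apply: le_Rintegral => //; first exact: integrable_norm.
by move=> t _; exact: ler_Im_normc.
Qed.

(** The index n enters only through t^n <= 1, which makes all later bounds uniform in n. *)
Lemma beta_integrand_shift (x y : R[i]) n t : 0 < t ->
  beta_integrand (x + n%:R) y t = beta_integrand x y t * t%:C ^+ n.
Proof.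
move=> t0; rewrite /beta_integrand [x + n%:R - 1]addrAC.
rewrite (rcpowD t (x - 1) n%:R) rcpow_nat// real_complexX.
by rewrite mulrAC.
Qed.

Lemma normc_beta_integrand (x y : R[i]) t : 0 < t < 1 ->
  normc (beta_integrand x y t) =
  t `^ (complex.Re x - 1) * (1 - t) `^ (complex.Re y - 1).
Proof.
move=> /andP[t0 t1]; rewrite /beta_integrand ComplexField.Normc.normcM.
by rewrite !normc_rcpow ?subr_gt0// !cReB.
Qed.

(** The term at argument 1 is the coefficient a_n of the power series. *)
Lemma Mseries_termE p q (alpha beta : R[i]) (kappa : p.-tuple R[i])
    (nu : q.-tuple R[i]) z n :
  Mseries_term alpha beta kappa nu z n =
  Mseries_term alpha beta kappa nu 1 n * z ^+ n.
Proof.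
rewrite /Mseries_term expr1n div1r -[RHS]mulrA; congr (_ * _); exact: mulrC.
Qed.

Lemma Cmeasurable_beta_integrand (x y : R[i]) d (T : measurableType d)
    (D : set T) (f : T -> R) : measurable_fun D f ->
  Cmeasurable D (fun t => beta_integrand x y (f t)).
Proof.
move=> mf; apply: CmeasurableM; first exact: Cmeasurable_rcpow.
apply: Cmeasurable_rcpow; apply: measurable_funB => //; exact: measurable_cst.
Qed.

(* The M-series with the extra numerator parameter 1 has general term m! a_m w^m
   and converges for arbitrarily large |w|: this makes the original M-series an
   entire function that grows more slowly than every exponential exp (c |w|). *)
Lemma Mseries_coeff_summable p q (alpha beta s : R[i]) (kappa : p.-tuple R[i])
    (nu : q.-tuple R[i]) : s != 0 ->
  (forall t : R, 0 < t < 1 -> Mseries_cvg alpha beta [tuple of rcons kappa 1] nu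
    (- (1 / s) / (t * (1 - t))%:C)) ->
  forall r, 0 <= r -> exists K, forall n, \sum_(0 <= k < n)
    normc (Mseries_term alpha beta kappa nu 1 k) * k`!%:R * r ^+ k <= K.
Proof.
move=> s0 cv r r0.
set c := fun k => normc (Mseries_term alpha beta kappa nu 1 k) * k`!%:R.
have ns : 0 < normc s.
  rewrite lt_neqAle normc_ge0 andbT eq_sym; apply/eqP.
  by move=> /ComplexField.Normc.eq0_normc /eqP; exact/negP.
(* Chosen so that 2 r |s| t <= 1, hence 1/(|s| t (1 - t)) >= 2 r, the doubled radius needed for the
   geometric comparison; the summand 2 keeps t below 1 even for r = 0. *)
pose t := (2 + 2 * r * normc s)^-1.
have rs0 : 0 <= r * normc s by rewrite mulr_ge0// ltW.
have d0 : 0 < 2 + 2 * r * normc s by rewrite -mulrA; lra.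
have t0 : 0 < t by rewrite invr_gt0.
have t1 : t < 1 by rewrite invf_lt1// -mulrA; lra.
have /Cseries_terms_bounded[B hB] : Mseries_cvg alpha beta
    [tuple of rcons kappa 1] nu (- (1 / s) / (t * (1 - t))%:C).
  by apply: cv; rewrite t0.
exists (B * 2); apply: bounded_terms_sum_le => //.
  by move=> k; rewrite /c mulr_ge0 ?normc_ge0.
move=> k; apply: le_trans (hB k).
rewrite Mseries_term_rcons1 (Mseries_termE _ _ _ _ (- (1 / s) / _)).
rewrite mulrA [leRHS]ComplexField.Normc.normcM normcX.
have -> : normc (k`!%:R * Mseries_term alpha beta kappa nu 1 k) = c k.
  rewrite ComplexField.Normc.normcM real_complex_nat normc_real.
  by rewrite (ger0_norm (ler0n R _)) mulrC.
rewrite ler_wpM2l ?mulr_ge0 ?normc_ge0// lerXn2r ?nnegrE ?normc_ge0 ?mulr_ge0//.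
have phi0 : 0 < t * (1 - t) by rewrite mulr_gt0// subr_gt0.
have -> : normc (- (1 / s) / (t * (1 - t))%:C) = (normc s)^-1 / (t * (1 - t)).
  rewrite ComplexField.Normc.normcM normcN div1r !ComplexField.Normc.normcV.
  by rewrite normc_real gtr0_norm.
rewrite ler_pdivlMr// -[leRHS]div1r ler_pdivlMr// (@le_trans _ _ (2 * r * t * normc s))//.
  rewrite ler_wpM2r ?(ltW ns)// ler_wpM2l ?mulr_ge0// -[leRHS]mulr1.
  by rewrite ler_wpM2l ?(ltW t0)//; lra.
rewrite mulrAC /t ler_pdivrMr//; lra.
Qed.

End Assembly.

Theorem theorem4p4 (R : realType) (p q : nat)
    (kappa : p.-tuple R[i]) (mu : q.-tuple R[i])
    (alpha beta lambda2 lambda3 s z : R[i])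
    (hkappa : forall i : 'I_p, nonpole (tnth kappa i))
    (hmu : forall j : 'I_q, nonpole (tnth mu j))
    (halpha : 0 < complex.Re alpha)
    (hlambda2 : 0 < complex.Re lambda2)
    (hlambda3 : complex.Re lambda2 < complex.Re lambda3)
    (hs : 0 < complex.Re s)
    (hleft : forall rho : R, 0 < rho ->
      Mconfluent_cvg alpha beta kappa mu lambda2 lambda3 z rho%:C)
    (hright :
      Mconfluent_cvg alpha beta [tuple of rcons kappa 1] mu
        lambda2 lambda3 z (1 / s)) :
  Cintegrable `]0, +oo[ (fun rho : R =>
    cexp (- s * rho%:C) *
    Mconfluent alpha beta kappa mu lambda2 lambda3 z rho%:C) /\
  Cintegral `]0, +oo[ (fun rho : R =>
    cexp (- s * rho%:C) *
    Mconfluent alpha beta kappa mu lambda2 lambda3 z rho%:C) =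
  1 / s * Mconfluent alpha beta [tuple of rcons kappa 1] mu
    lambda2 lambda3 z (1 / s).
Proof.
set y := lambda3 - lambda2.
have X0 : 0 < complex.Re lambda2 by [].
have Y0 : 0 < complex.Re y by rewrite cReB subr_gt0.
have s0 : s != 0 by apply: contraTneq hs => ->; rewrite ltxx.
(* The pointwise convergence of the right-hand M-series for all t in ]0, 1[ is part of the
   convergence of its M-beta function, read here at n = 0. *)
have ha := Mseries_coeff_summable s0 (hright.1 0).1.
set a := Mseries_term alpha beta kappa mu 1 in ha.
pose phi (t : R) := t * (1 - t).
pose u t : R := - (phi t)^-1.
have uC t : (u t)%:C = - (phi t)%:C^-1 by rewrite /u rmorphN fmorphV.
have phi0 (t : R) : 0 < t < 1 -> 0 < phi t.
  by move=> /andP[t0 t1]; rewrite mulr_gt0// subr_gt0.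
have ME (rho t : R) : Mseries alpha beta kappa mu (- rho%:C / (phi t)%:C) =
    entire_sum a (rho * u t).
  congr Cseries_sum; apply/funext => k.
  rewrite (Mseries_termE _ _ _ _ (- _ / _)); congr (_ * _ ^+ _).
  have -> : (rho * u t)%:C = rho%:C * (u t)%:C by exact: rmorphM.
  by rewrite uC mulrN mulNr.
have MEr (t : R) : Mseries alpha beta [tuple of rcons kappa 1] mu
    (- (1 / s) / (phi t)%:C) =
    Cseries_sum (fun k => k`!%:R * a k * ((u t)%:C / s) ^+ k).
  congr Cseries_sum; apply/funext => k.
  rewrite Mseries_term_rcons1 (Mseries_termE _ _ _ _ (- _ / _)) mulrA.
  congr (_ * _ ^+ _).
  by rewrite uC div1r !mulNr mulrC.
(* From here on, the summability [ha] and the two expansions [ME] and [MEr] carry everything that is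
   used about the coefficients. *)
clearbody a.
pose b n t : R[i] := beta_integrand (lambda2 + n%:R) y t.
have bnorm n (t : R) : 0 < t < 1 ->
    normc (b n t) <= t `^ (complex.Re lambda2 - 1) * (1 - t) `^ (complex.Re y - 1).
  move=> t01; have /andP[t0 t1] := t01.
  rewrite /b beta_integrand_shift// ComplexField.Normc.normcM normcX normc_real.
  rewrite normc_beta_integrand// (ger0_norm (ltW t0)) -[leRHS]mulr1.
  by rewrite ler_wpM2l ?mulr_ge0 ?powR_ge0// exprn_ile1 ?(ltW t0) ?(ltW t1).
(* Growth at rate c in rho against decay at rate 2 c leaves exp (- c rho). *)
pose c : R := complex.Re s / 2.
have c0 : 0 < c by rewrite divr_gt0.
have cs : complex.Re s = c + c by rewrite -splitr.
pose D1 : set R := `]0, +oo[%classic.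
pose D2 : set R := `]0, 1[%classic.
have mD1 : measurable D1 by exact: measurable_itv.
have mD2 : measurable D2 by exact: measurable_itv.
have D1P rho : D1 rho -> 0 < rho by rewrite /D1/= in_itv/= andbT.
have D2P t : D2 t -> 0 < t < 1 by rewrite /D2/= in_itv.
pose g v := normc (entire_sum a (- v)).
have cg : continuous g.
  move=> v; apply: (@continuous_comp _ _ _ -%R (fun v => normc (entire_sum a v))).
    exact: opp_continuous.
  exact: continuous_normc_entire_sum.
have g0 v : 0 <= g v by exact: normc_ge0.
have gexp d : 0 < d -> exists2 K, 0 <= K & forall v, g v <= K * expR (d * `|v|).
  move=> /(normc_entire_sum ha)[K K0 hK]; exists K; first exact: K0.
  by move=> v; rewrite -(normrN v); exact: (hK (- v)).
have Mint (rho : R) n : 0 < rho ->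
    Cintegrable D2 (fun t => b n t * entire_sum a (rho * u t)).
  move=> rho0; have [/(_ n)[_ +] _] := hleft rho rho0.
  by apply: eq_Cintegrable => // t _; rewrite /Mbeta_integrand ME.
have gu (rho t : R) : normc (entire_sum a (rho * u t)) = g (rho / phi t).
  by rewrite /g /u mulrN.
(* Finiteness at scale 1 is the convergence of the M-beta integral for rho = 1 and n = 0. *)
have [C C0 hC] : exists2 C, 0 <= C & forall rho, 0 < rho ->
    (\int[lebesgue_measure]_(t in `]0%R, 1%R[)
      (t `^ (complex.Re lambda2 - 1) * (1 - t) `^ (complex.Re y - 1) *
       g (rho / (t * (1 - t))))%:E <= (C * expR (c * rho))%:E)%E.
  apply: beta_dilation_bound => //.
  have /integrableP[_] := Cintegrable_normc mD2 (Mint 1 0 ltr01).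
  congr (_ < _)%E; apply: eq_integral => t /set_mem/D2P t01.
  rewrite /= ComplexField.Normc.normcM gu /b addr0 normc_beta_integrand//.
  by rewrite ger0_norm// !mulr_ge0 ?powR_ge0.
(* The weight for n is dominated by the weight for n = 0, so the same [C] serves for every n; the
   domination of the sum over n depends on this. *)
have absM (rho : R) n : 0 < rho -> (\int[lebesgue_measure]_(t in D2)
    (normc (b n t * entire_sum a (rho * u t)))%:E <= (C * expR (c * rho))%:E)%E.
  move=> rho0; apply: le_trans (hC rho rho0); apply: ge0_le_integral => //.
  - by move=> t _; rewrite lee_fin normc_ge0.
  - apply/measurable_EFinP; apply: measurable_normc.
    exact: Cintegrable_measurable (Mint rho n rho0).
  - by apply/measurable_EFinP; exact: measurable_beta_weight.
  move=> t /D2P t01; rewrite lee_fin ComplexField.Normc.normcM gu ler_wpM2r//.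
  exact: bnorm.
have expcs (rho : R) :
    expR (complex.Re (- s * rho%:C)) * expR (c * rho) = expR (- c * rho).
  rewrite -expRD cReM cReN cs /= mulr0 subr0; congr (expR _); ring.
have iexp K : (@lebesgue_measure R).-integrable D1
    (EFin \o (fun rho => K * expR (- c * rho))).
  apply: integrableS (integrable_expRN K c0) => // rho /D1P rho0.
  by rewrite /= in_itv/= andbT ltW.
have fub n :
    Cintegrable D1 (fun rho : R => cexp (- s * rho%:C) *
      Mbeta alpha beta kappa mu (lambda2 + n%:R) y rho%:C) /\
    Cintegral D1 (fun rho : R => cexp (- s * rho%:C) *
      Mbeta alpha beta kappa mu (lambda2 + n%:R) y rho%:C) =
    1 / s * Mbeta alpha beta [tuple of rcons kappa 1] mu
      (lambda2 + n%:R) y (1 / s).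
  pose k (rho t : R) := cexp (- s * rho%:C) * (b n t * entire_sum a (rho * u t)).
  have kE (rho : R) : D1 rho -> Cintegral D2 (k rho) =
      cexp (- s * rho%:C) * Mbeta alpha beta kappa mu (lambda2 + n%:R) y rho%:C.
    move=> /D1P rho0; rewrite (CintegralZl _ mD2 (Mint rho n rho0)).2.
    by congr (_ * _); apply: eq_Cintegral => t _; rewrite /Mbeta_integrand ME.
  have lap t : Cintegrable D1 (k^~ t) /\ Cintegral D1 (k^~ t) =
      1 / s * (b n t * Mseries alpha beta [tuple of rcons kappa 1] mu
        (- (1 / s) / (phi t)%:C)).
    have [l1 l2] := laplace_entire_sum ha (u t) hs.
    have [l3 l4] := CintegralZl (b n t) mD1 l1.
    have kt : {in D1, (fun rho : R => b n t * (cexp (- s * rho%:C) *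
        entire_sum a (rho * u t))) =1 k^~ t}.
      by move=> rho _; rewrite /k mulrCA.
    split; first exact: eq_Cintegrable kt l3.
    by rewrite -(eq_Cintegral kt) l4 l2 MEr mulrCA.
  have mk : Cmeasurable (D1 `*` D2) (fun w => k w.1 w.2).
    apply: CmeasurableM.
      apply: Cmeasurable_cexp; apply: CmeasurableM; first exact: Cmeasurable_cst.
      by apply: Cmeasurable_real; apply: measurable_funTS; exact: measurable_fst.
    apply: CmeasurableM.
      apply: Cmeasurable_beta_integrand; apply: measurable_funTS.
      exact: measurable_snd.
    apply: (Cmeasurable_entire_sum ha); apply: measurable_funM.
      by apply: measurable_funTS; exact: measurable_fst.
    apply: (@measurable_funN _ _ _ _ (fun w : R * R => (phi w.2)^-1)).
    apply: measurable_funV_ge0; last first.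
      by move=> w [_ /D2P/phi0 w0]; exact: ltW.
    have msnd : measurable_fun (D1 `*` D2) (snd : R * R -> R).
      by apply: measurable_funTS; exact: measurable_snd.
    apply: measurable_funM => //.
    by apply: measurable_funB => //; exact: measurable_cst.
  have kH (rho : R) : D1 rho ->
      (\int[lebesgue_measure]_(t in D2) (normc (k rho t))%:E <=
       (C * expR (- c * rho))%:E)%E.
    move=> /D1P rho0.
    rewrite -expcs mulrCA EFinM.
    apply: le_trans (lee_wpmul2l _ (absM rho n rho0)); last first.
      by rewrite lee_fin expR_ge0.
    rewrite -ge0_integralZl_EFin ?expR_ge0//; last 2 first.
    - by move=> t _; rewrite lee_fin normc_ge0.
    - apply/measurable_EFinP; apply: measurable_normc.
      exact: Cintegrable_measurable (Mint rho n rho0).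
    rewrite le_eqVlt; apply/orP; left; apply/eqP; apply: eq_integral => t _.
    by rewrite /k (ComplexField.Normc.normcM (cexp _)) normc_cexp.
  (* The outer variable is rho, since the bound [kH] controls the t-integral; for fixed t, the
     integral in rho is the Laplace transform of an entire series. *)
  have [i1 e1] := CFubini mD1 mD2 mk (iexp C) kH (fun t _ => (lap t).1).
  split.
    apply: (eq_Cintegrable mD1 _ i1) => rho /set_mem Drho.
    exact: kE.
  transitivity (Cintegral D1 (fun rho => Cintegral D2 (k rho))).
    by apply: eq_Cintegral => rho /set_mem Drho; exact/esym/kE.
  rewrite e1 -(CintegralZl _ mD2 (hright.1 n).2).2.
  apply: eq_Cintegral => t _.
  exact: (lap t).2.
set B := Beta lambda2 y.
(* 2 C bounds the M-beta functions uniformly in n, 1/|B| is the normalisation, and exp |z| bounds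
   the partial sums of |z|^n / n!. *)
pose K := 2 * C / normc B * expR (normc z).
have K0 : 0 <= 2 * C / normc B by rewrite !mulr_ge0 ?invr_ge0 ?normc_ge0.
pose G n (rho : R) := cexp (- s * rho%:C) *
  Mconfluent_term alpha beta kappa mu lambda2 lambda3 z rho%:C n.
have GE n (rho : R) : G n rho = (B^-1 * (z ^+ n / (n`!)%:R)) *
    (cexp (- s * rho%:C) * Mbeta alpha beta kappa mu (lambda2 + n%:R) y rho%:C).
  by rewrite /G /Mconfluent_term -/y -/B; ring.
have Gint n := CintegralZl (B^-1 * (z ^+ n / (n`!)%:R)) mD1 (fub n).1.
have nMbeta n (rho : R) : 0 < rho ->
    normc (Mbeta alpha beta kappa mu (lambda2 + n%:R) y rho%:C) <=
    2 * (C * expR (c * rho)).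
  move=> rho0; apply: normc_Cintegral => //.
    exact: ((hleft rho rho0).1 n).2.
  apply: le_trans (absM rho n rho0).
  rewrite le_eqVlt; apply/orP; left; apply/eqP; apply: eq_integral => t _.
  by rewrite /Mbeta_integrand ME.
have GH n (rho : R) : D1 rho ->
    \sum_(0 <= k < n) normc (G k rho) <= K * expR (- c * rho).
  move=> /D1P rho0.
  apply: (@le_trans _ _ (\sum_(0 <= k < n)
    2 * C / normc B * expR (- c * rho) * (normc z ^+ k / k`!%:R))).
    apply: ler_sum => k _; rewrite GE.
    move: (Mbeta _ _ _ _ _ _ _) (nMbeta k rho rho0) => m mle.
    rewrite (ComplexField.Normc.normcM (B^-1 * _)).
    rewrite (ComplexField.Normc.normcM (cexp _)) normc_cexp.
    rewrite (ComplexField.Normc.normcM B^-1) (ComplexField.Normc.normcM (z ^+ k)).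
    rewrite !ComplexField.Normc.normcV normcX real_complex_nat normc_real.
    rewrite (ger0_norm (ler0n R _)) -expcs; set E := expR (complex.Re _).
    have zk0 : 0 <= (normc B)^-1 * (normc z ^+ k / k`!%:R) * E.
      by rewrite !mulr_ge0 ?invr_ge0 ?normc_ge0 ?exprn_ge0 ?expR_ge0 ?normc_ge0.
    rewrite mulrA (le_trans (ler_wpM2l zk0 mle))// le_eqVlt; apply/orP; left.
    apply/eqP; ring.
  rewrite -mulr_sumr /K mulrAC ler_wpM2r ?expR_ge0// ler_wpM2l//.
  exact: sum_exp_coeff_le (normc_ge0 _).
have Gm n : Cmeasurable D1 (G n).
  apply: eq_Cmeasurable (Cintegrable_measurable (Gint n).1) => rho _.
  by rewrite GE.
(* The sum over n is exchanged with the rho-integral, with K exp (- c rho) as majorant. *)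
have [_ i2 e2] := Cintegral_series mD1 Gm (iexp K) GH.
have GsumE : {in D1, (fun rho => Cseries_sum (G^~ rho)) =1 (fun rho : R =>
    cexp (- s * rho%:C) *
    Mconfluent alpha beta kappa mu lambda2 lambda3 z rho%:C)}.
  by move=> rho /set_mem/D1P/hleft[_]; exact: Cseries_sumZl.
split; first exact: eq_Cintegrable GsumE i2.
rewrite -(eq_Cintegral GsumE) e2 -(Cseries_sumZl _ hright.2).
congr Cseries_sum; apply/funext => n.
rewrite (eq_Cintegral (fun rho _ => GE n rho)) (Gint n).2 (fub n).2.
by rewrite /Mconfluent_term -/y -/B; ring.
Qed.
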